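(* Let $g\colon\mathbb{R}_{\ge 0}\to\mathbb{R}_{\ge 0}$ be strictly increasing, super-additive and (eventually) log-concave. Then there exists a unimodular random rooted tree $(\mathcal T,\omega)$ of uniform growth $g$, that is, a unimodular random rooted graph $(\mathcal T,\omega)$ that is almost surely a tree and for which there are constants $c_1,C_1,c_2,C_2\in\mathbb{R}_{>0}$ such that almost surely $$C_1\cdot g(c_1 r)\;\le\;|B_{\mathcal T}(v,r)|\;\le\;C_2\cdot g(c_2 r)\qquad\text{for all } r\ge 0\text{ and all } v\in V(\mathcal T).$$
   Context: All graphs are simple. For a graph $G$, $v\in V(G)$ and $r\ge 0$, $B_G(v,r):=\{w\in V(G)\mid d_G(v,w)\le r\}$, where $d_G$ is the graph distance. A function $g$ is super-additive if $g(r_1+r_2)\ge g(r_1)+g(r_2)$ for all $r_1,r_2\ge 0$. It is log-concave if $\alpha\log g(x)+\beta\log g(y)\le\log g(\alpha x+\beta y)$ for all $x,y$ and all $\alpha,\beta\in[0,1]$ with $\alpha+\beta=1$, and eventually log-concave if there is $R>0$ such that this holds for all $x,y\ge R$. A rooted graph is a pair $(G,o)$ with $G$ a graph and $o\in V(G)$; isomorphisms of rooted graphs preserve roots, and rooted graphs are considered up to isomorphism. The local topology on locally finite connected rooted graphs is induced by the metric $\mathrm{dist}((G,o),(G',o'))=2^{-R}$, where $R$ is the largest integer such that $B_G(o,r)\cong B_{G'}(o',r)$ as rooted graphs for all $0\le r\le R$ (distance $0$ if no largest such $R$ exists). A random rooted graph is a Borel probability measure on the set of locally finite connected rooted graphs.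 A random rooted graph $(G,o)$ is unimodular if it obeys the mass transport principle $$\mathbb E\Big[\sum_{x\in V(G)}f(G,o,x)\Big]=\mathbb E\Big[\sum_{x\in V(G)}f(G,x,o)\Big]$$ for every non-negative real Borel function $f$ on (isomorphism classes of) locally finite connected graphs with an ordered pair of distinguished vertices.
   Formalization: The upper bound |B(v,r)| ≤ C_2 g(c_2 r) is claimed only for r ≥ 1 instead of all r ≥ 0: super-additivity forces g(0)=0 while |B(v,0)|=1, so it fails at r=0; the lower bound is kept for all r ≥ 0. *)

(* Defs.v *)
(* MathComp / MathComp-Analysis *)
From HB Require Import structures.
From mathcomp Require Import all_boot all_order all_algebra.
From mathcomp Require Import all_classical all_reals all_analysis.

Set Implicit Arguments.
Unset Strict Implicit.
Unset Printing Implicit Defensive.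

Import Order.TTheory GRing.Theory Num.Theory.
Local Open Scope classical_set_scope.
Local Open Scope ring_scope.
Local Open Scope quotient_scope.

(* Simple, locally finite, connected graphs.  Such graphs are countable, so up
   to isomorphism their vertex set may be taken to be a set of naturals. *)
Record lfgraph := LFGraph {
  vtx : set nat;
  adj : rel nat;
  adj_vtx : forall u v, adj u v -> vtx u;
  adj_sym : symmetric adj;
  adj_irr : irreflexive adj;
  adj_lf : forall u, finite_set [set v | adj u v];
  adj_conn : forall u v, vtx u -> vtx v ->
    exists2 p, path adj u p & last u p = v }.

Definition vertex (G : lfgraph) : Type := set_type (vtx G).

Section graph_distance.
Variable G : lfgraph.

Definition walk (u v : nat) (n : nat) : Prop :=
  exists2 p, path (adj G) u p & last u p = v /\ size p = n.

Definition gdist (u v : nat) : nat :=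
  xget 0%N [set n | walk u v n /\ forall m, walk u v m -> (n <= m)%N].

Definition gball (R : realType) (v : nat) (r : R) : set nat :=
  [set w | vtx G w /\ (gdist v w)%:R <= r].

Definition is_tree : Prop :=
  forall c : seq nat, ucycle (adj G) c -> (size c < 3)%N.

End graph_distance.

(* k = 0: rooted graphs; k = 1: graphs with an ordered pair of distinguished
   vertices (not necessarily distinct). *)
Record mgraph (k : nat) := MGraph {
  ugraph :> lfgraph;
  mark : 'I_k.+1 -> vertex ugraph }.

HB.instance Definition _ k := gen_eqMixin (mgraph k).
HB.instance Definition _ k := gen_choiceMixin (mgraph k).

Section isomorphism.
Variable k : nat.
Implicit Types (G H K : mgraph k) (A B C : set nat).

Definition rootn G (i : 'I_k.+1) : nat := \val (mark G i).

(* for one root, this is the ball around the root *)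
Definition mball G (n : nat) : set nat :=
  [set w | vtx G w /\ exists i, (gdist G (rootn G i) w <= n)%N].

Definition induced_iso G H A B (f : nat -> nat) : Prop :=
  [/\ set_bij A B f,
      forall u v, A u -> A v -> adj H (f u) (f v) = adj G u v &
      forall i, f (rootn G i) = rootn H i].

Definition mg_iso G H : Prop := exists f, induced_iso G H (vtx G) (vtx H) f.

Definition ball_iso (n : nat) G H : Prop :=
  exists f, induced_iso G H (mball G n) (mball H n) f.

Definition agree_upto G H (z : int) : Prop :=
  forall r : nat, r%:Z <= z -> ball_iso r G H.

(* With a single root the balls of radius 0 always agree.  With two roots they
   need not; the largest z is then -1. *)
Definition loc_dist (R : realType) G H : R :=
  let largest := [set z : int | agree_upto G H z /\
                                forall z', agree_upto G H z' -> z' <= z] in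
  if `[< largest !=set0 >] then 2 ^ (- xget 0 largest) else 0.

Lemma rootP G i : vtx G (rootn G i).
Proof. exact: set_mem (valP (mark G i)). Qed.

Lemma path_vtx (G : lfgraph) u p : vtx G u -> path (adj G) u p ->
  vtx G (last u p).
Proof.
elim: p u => [|v p IH] u Vu //= /andP[uv]; apply: IH.
by move: uv; rewrite adj_sym => /adj_vtx.
Qed.

Lemma gdistP (G : lfgraph) u v : vtx G u -> vtx G v ->
  walk G u v (gdist G u v) /\ forall m, walk G u v m -> (gdist G u v <= m)%N.
Proof.
move=> Vu Vv.
have [p pp lp] := adj_conn Vu Vv.
have ex : exists n, `[< walk G u v n >].
  by exists (size p); apply/asboolP; exists p.
rewrite /gdist.
apply: (@xgetPex _ 0%N [set n | walk G u v n /\ forall m, walk G u v m -> (n <= m)%N]).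
case: (ex_minnP ex) => n /asboolP wn min; exists n; split=> // m wm.
by apply: min; apply/asboolP.
Qed.

Lemma mballP G n w : mball G n w <-> exists i p,
  [/\ path (adj G) (rootn G i) p, last (rootn G i) p = w & (size p <= n)%N].
Proof.
split.
  move=> [Vw [i le]]; have [[p pp [lp sp]] _] := gdistP (rootP G i) Vw.
  by exists i, p; split=> //; rewrite sp.
move=> [i [p [pp lp sp]]].
have Vw : vtx G w by rewrite -lp; exact: path_vtx (rootP G i) pp.
split=> //; exists i; apply: leq_trans sp.
by apply: (gdistP (rootP G i) Vw).2; exists p.
Qed.

Lemma mball_le G m n : (m <= n)%N -> mball G m `<=` mball G n.
Proof. by move=> mn w [Vw [i le]]; split=> //; exists i; exact: leq_trans mn. Qed.

Lemma mball_root G n i : mball G n (rootn G i).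
Proof. by apply/mballP; exists i, [::]. Qed.

Lemma mball_vtx G n : mball G n `<=` vtx G.
Proof. by move=> w []. Qed.

Lemma vtx_mball G w : vtx G w -> exists n, mball G n w.
Proof. by move=> Vw; exists (gdist G (rootn G ord0) w); split=> //; exists ord0. Qed.

Lemma finite_mball G n : finite_set (mball G n).
Proof.
have finw u m : finite_set [set w | walk G u w m].
  elim: m u => [|m IH] u.
    apply: (@sub_finite_set _ _ [set u]); last exact: finite_set1.
    by move=> w [p _ [<-]] /size0nil ->.
  apply: (@sub_finite_set _ _
    (\bigcup_(x in [set x | adj G u x]) [set w | walk G x w m])).
    move=> w [[|x p]]; first by move=> _ [].
    by move=> /= /andP[ux pp] [lp [sp]]; exists x => //; exists p.
  by apply: bigcup_finite => [|x _]; [exact: adj_lf|exact: IH].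
apply: (@sub_finite_set _ _ (\bigcup_(m in `I_n.+1)
  \bigcup_(i in [set: 'I_k.+1]) [set w | walk G (rootn G i) w m])).
  move=> w /mballP[i [p [pp lp sp]]].
  by exists (size p) => //=; exists i => //; exists p.
apply: bigcup_finite => [|m _]; first exact: finite_II.
by apply: bigcup_finite => [|i _]; [exact: finite_finset|exact: finw].
Qed.

Lemma induced_iso_id G A : induced_iso G G A A id.
Proof.
split=> //; split=> [x Ax //|x y _ _ //|x Ax]; by exists x.
Qed.

Lemma induced_iso_comp G H K A B C f g :
  induced_iso G H A B f -> induced_iso H K B C g ->
  induced_iso G K A C (g \o f).
Proof.
move=> [bf ef rf] [bg eg rg]; split; first exact: set_bij_comp bf bg.
  by move=> u v Au Av /=; rewrite eg ?ef//; apply: (set_bij_homo bf).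
by move=> i /=; rewrite rf rg.
Qed.

Lemma induced_iso_inv G H A B f : (forall i, A (rootn G i)) ->
  induced_iso G H A B f -> exists g, induced_iso H G B A g.
Proof.
move=> rA [bf ef rf].
have [hom inj sur] := bf.
pose g w := xget 0%N [set v | A v /\ f v = w].
have gP w : B w -> A (g w) /\ f (g w) = w.
  move=> Bw; apply: (@xgetPex _ 0%N [set v | A v /\ f v = w]).
  by have [v Av fv] := sur _ Bw; exists v.
have gf v : A v -> g (f v) = v.
  move=> Av; have [Ag fg] := gP _ (hom _ Av).
  by apply: inj => //; apply/mem_set.
exists g; split.
- split=> [w /gP[] //|w1 w2 /set_mem/gP[_ e1] /set_mem/gP[_ e2] e|v Av].
    by rewrite -e1 -e2 e.
  by exists (f v); [exact: hom|exact: gf].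
- move=> w1 w2 /gP[A1 e1] /gP[A2 e2].
  by rewrite -ef // e1 e2.
- by move=> i; rewrite -rf gf.
Qed.

Lemma ball_iso_refl n G : ball_iso n G G.
Proof. by exists id; exact: induced_iso_id. Qed.

Lemma ball_iso_sym n G H : ball_iso n G H -> ball_iso n H G.
Proof. by move=> [f] /(induced_iso_inv (mball_root G n)). Qed.

Lemma ball_iso_trans n G H K :
  ball_iso n G H -> ball_iso n H K -> ball_iso n G K.
Proof. by move=> [f If] [g Ig]; exists (g \o f); exact: induced_iso_comp If Ig. Qed.

Lemma mg_iso_refl G : mg_iso G G.
Proof. by exists id; exact: induced_iso_id. Qed.

Lemma mg_iso_sym G H : mg_iso G H -> mg_iso H G.
Proof. by move=> [f] /(induced_iso_inv (@rootP G)). Qed.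

Lemma mg_iso_trans G H K : mg_iso G H -> mg_iso H K -> mg_iso G K.
Proof. by move=> [f If] [g Ig]; exists (g \o f); exact: induced_iso_comp If Ig. Qed.

Lemma induced_iso_mball G H A B f m : mball G m `<=` A ->
  induced_iso G H A B f -> forall w, mball G m w -> mball H m (f w).
Proof.
move=> mA [bf ef rf] w /mballP[i [p [pp <- sp]]]; apply/mballP.
suff [q [pq lq sq]] : exists q, [/\ path (adj H) (rootn H i) q,
    last (rootn H i) q = f (last (rootn G i) p) & size q = size p].
  by exists i, q; rewrite sq.
elim/last_ind: p pp sp => [|p x IH]; first by exists [::]; rewrite /= rf.
rewrite rcons_path size_rcons last_rcons => /andP[pp px] sp.
have [q [pq lq sq]] := IH pp (ltnW sp).
exists (rcons q (f x)); rewrite last_rcons size_rcons sq; split=> //.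
rewrite rcons_path pq lq ef //; apply: mA; apply/mballP; exists i.
  by exists p; split=> //; exact: ltnW.
by exists (rcons p x); rewrite rcons_path pp last_rcons size_rcons.
Qed.

Lemma induced_iso_mball_sur G H A B f m : mball G m `<=` A ->
  mball H m `<=` B -> induced_iso G H A B f ->
  forall w, mball H m w -> exists2 v, mball G m v & f v = w.
Proof.
move=> mA mB [[_ _ sf] ef rf] w /mballP[i [p [pp <- sp]]].
suff [q [pq lq sq]] : exists q, [/\ path (adj G) (rootn G i) q,
    f (last (rootn G i) q) = last (rootn H i) p & size q = size p].
  exists (last (rootn G i) q) => //.
  by apply/mballP; exists i, q; rewrite sq.
elim/last_ind: p pp sp => [|p x IH]; first by exists [::]; rewrite /= rf.
rewrite rcons_path size_rcons last_rcons => /andP[pp px] sp.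
have [q [pq lq sq]] := IH pp (ltnW sp).
have /mB/sf[y Ay yx] : mball H m x.
  apply/mballP; exists i, (rcons p x).
  by rewrite rcons_path pp last_rcons size_rcons.
exists (rcons q y); rewrite rcons_path last_rcons size_rcons pq sq yx.
split=> //=; rewrite -ef // ?lq ?yx //.
by apply: mA; apply/mballP; exists i, q; rewrite sq ltnW.
Qed.

Lemma mg_iso_ball n G H : mg_iso G H -> ball_iso n G H.
Proof.
move=> [f If]; exists f.
have [[hf jf sf] ef rf] := If.
split=> [|u v /mball_vtx Vu /mball_vtx Vv|//]; last exact: ef.
split.
- by move=> w; exact: (induced_iso_mball (@mball_vtx G n) If).
- move=> u v /set_mem/mball_vtx Vu /set_mem/mball_vtx Vv.
  by apply: jf; exact: mem_set.
- exact: (induced_iso_mball_sur (@mball_vtx G n) (@mball_vtx H n) If).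
Qed.

Lemma ultra_fin (F : set_system nat) (A : set nat) (f : nat -> nat) :
  UltraFilter F -> finite_set A -> F [set n | A (f n)] ->
  exists2 w, A w & F [set n | f n = w].
Proof.
move=> UF /finite_seqP[s ->]; elim: s => [|a s IH] Fs.
  by have [n] := filter_ex Fs.
have [Fa|Fa] := in_ultra_setVsetC [set n | f n = a] UF.
  by exists a => //=; rewrite inE eqxx.
have [|w ws Fw] := IH.
  apply: filterS2 Fs Fa => n /=; rewrite inE => /orP[/eqP -> //|//].
by exists w => //=; rewrite inE ws orbT.
Qed.

(* by compactness, as all balls are finite *)
Lemma all_balls_iso G H : (forall n, ball_iso n G H) -> mg_iso G H.
Proof.
move=> /choice[f If].
have [U [UF sU]] := @ultraFilterLemma nat \oo _.
have large m : U [set n | (m <= n)%N] by apply: sU; exists m.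
have exl v : vtx G v -> exists w, U [set n | f n v = w].
  move=> /vtx_mball[m mv].
  have [|w _ Uw] := @ultra_fin U (mball H m) (f^~ v) UF (finite_mball H m).
    apply: filterS (large m) => n /= mn.
    exact: (induced_iso_mball (mball_le mn) (If n)).
  by exists w.
pose h v := xget 0%N [set w | U [set n | f n v = w]].
have hP v : vtx G v -> U [set n | f n v = h v].
  by move=> /exl; exact: (@xgetPex _ 0%N [set w | U [set n | f n v = w]]).
have inG v : vtx G v -> U [set n | mball G n v].
  move=> /vtx_mball[m mv]; apply: filterS (large m) => n mn.
  exact: mball_le mn _ mv.
exists h; split; first split.
- move=> v Vv; have [n [/= <- mv]] := filter_ex (filterI (hP _ Vv) (inG _ Vv)).
  by have [[hom _ _] _ _] := If n; apply: (@mball_vtx H n); exact: hom.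
- move=> u v /set_mem Vu /set_mem Vv huv.
  have [n [[/= eu ev] [mu mv]]] := filter_ex
    (filterI (filterI (hP _ Vu) (hP _ Vv)) (filterI (inG _ Vu) (inG _ Vv))).
  have [[_ inj _] _ _] := If n.
  by apply: inj; rewrite ?eu ?ev //; exact: mem_set.
- move=> w /vtx_mball[m mw].
  have /choice[q qP] n : exists v, (m <= n)%N -> mball G m v /\ f n v = w.
    have [mn|_] := boolP (m <= n)%N; last by exists 0%N.
    have [v mv fv] :=
      induced_iso_mball_sur (mball_le mn) (mball_le mn) (If n) mw.
    by exists v.
  have [|v mv Uv] := @ultra_fin U (mball G m) q UF (finite_mball G m).
    by apply: filterS (large m) => n /= /qP[].
  have Vv := mball_vtx mv; exists v => //.
  have [n [[/= qv fv] mn]] := filter_ex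
    (filterI (filterI Uv (hP _ Vv)) (large m)).
  by rewrite -fv -qv; case: (qP _ mn).
- move=> u v Vu Vv.
  have [n [[/= eu ev] [mu mv]]] := filter_ex
    (filterI (filterI (hP _ Vu) (hP _ Vv)) (filterI (inG _ Vu) (inG _ Vv))).
  by have [_ ef _] := If n; rewrite -eu -ev ef.
- move=> i; have [n /= <-] := filter_ex (hP _ (rootP G i)).
  by have [_ _ ->] := If n.
Qed.

Lemma loc_distE (R : realType) G H :
  ((forall n, ball_iso n G H) /\ loc_dist R G H = 0) \/
  exists n, [/\ ~ ball_iso n G H, forall m, (m < n)%N -> ball_iso m G H &
    loc_dist R G H = 2 / 2 ^+ n].
Proof.
rewrite /loc_dist; set L := [set z : int | _].
have [all|/existsNP ex] := pselect (forall n, ball_iso n G H).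
  left; split=> //; rewrite asboolF // => -[z [_ /(_ (z + 1))]].
  by rewrite gerDl => /(_ (fun r _ => all r)).
right; have {}ex : exists n, ~~ `[< ball_iso n G H >].
  by case: ex => n Hn; exists n; apply/asboolPn.
case: (ex_minnP ex) => n /asboolPn Hn min.
have lt m : (m < n)%N -> ball_iso m G H.
  by move=> mn; apply: contrapT => /asboolPn/min; rewrite leqNgt mn.
have Ln : L (n%:Z - 1).
  split=> [r|z Hz].
    by rewrite lerBrDr -PoszD lez_nat addn1; exact: lt.
  rewrite leNgt; apply/negP => nz; apply: Hn; apply: Hz.
  by move: nz; rewrite ltrBlDr ltzD1.
exists n; split=> //; rewrite asboolT; last by exists (n%:Z - 1).
have -> : xget 0 L = n%:Z - 1.
  have [Lx mx] : L (xget 0 L) by apply: (@xgetPex _ 0 L); exists (n%:Z - 1).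
  by apply/eqP; rewrite eq_le Ln.2 //=; apply: mx; case: Ln.
by rewrite opprB expfzDr // expr1z exprnN.
Qed.

Lemma loc_dist0 (R : realType) G H : loc_dist R G H = 0 -> mg_iso G H.
Proof.
case: (loc_distE R G H) => [[all _] _|[n [_ _ ->]] /eqP].
  exact: all_balls_iso.
by rewrite gt_eqF // divr_gt0 // exprn_gt0.
Qed.

Lemma loc_distxx (R : realType) G : loc_dist R G G = 0.
Proof. by case: (loc_distE R G G) => [[]//|[n [[]]]]; exact: ball_iso_refl. Qed.

Lemma loc_dist_agree (R : realType) G H G' H' :
  (forall n, ball_iso n G H <-> ball_iso n G' H') ->
  loc_dist R G H = loc_dist R G' H'.
Proof.
move=> E; rewrite /loc_dist.
suff -> : agree_upto G H = agree_upto G' H' by [].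
by apply/funext => z; apply/propext; split=> A r /A /E.
Qed.

Lemma loc_dist_sym (R : realType) G H : loc_dist R G H = loc_dist R H G.
Proof. by apply: loc_dist_agree => n; split; exact: ball_iso_sym. Qed.

Lemma loc_dist_iso (R : realType) G H G' H' : mg_iso G G' -> mg_iso H H' ->
  loc_dist R G H = loc_dist R G' H'.
Proof.
move=> GG' HH'; apply: loc_dist_agree => n.
have {GG'} GG' := mg_iso_ball n GG'; have {HH'} HH' := mg_iso_ball n HH'.
split=> E.
  exact: ball_iso_trans (ball_iso_sym GG') (ball_iso_trans E HH').
exact: ball_iso_trans GG' (ball_iso_trans E (ball_iso_sym HH')).
Qed.

Lemma loc_dist_ge0 (R : realType) G H : 0 <= loc_dist R G H.
Proof.
case: (loc_distE R G H) => [[_ ->]//|[n [_ _ ->]]].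
by rewrite divr_ge0 // exprn_ge0.
Qed.

Lemma loc_dist_ultra (R : realType) H G K :
  loc_dist R G K <= Num.max (loc_dist R G H) (loc_dist R H K).
Proof.
case: (loc_distE R G K) => [[_ ->]|[n [Hn _ ->]]].
  by rewrite le_max loc_dist_ge0.
have le G' H' : ~ ball_iso n G' H' -> 2 / 2 ^+ n <= loc_dist R G' H'.
  case: (loc_distE R G' H') => [[]//|[m [_ mm ->]] Hn'].
  rewrite ler_pM2l // lef_pV2 ?posrE ?exprn_gt0 // ler_weXn2l ?ler1n //.
  by rewrite leqNgt; apply/negP => /mm.
rewrite le_max; apply/orP.
have [GH|/le ->] := pselect (ball_iso n G H); last by left.
have [HK|/le ->] := pselect (ball_iso n H K); last by right.
by case: Hn; exact: ball_iso_trans GH HK.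
Qed.

Lemma loc_dist_triangle (R : realType) H G K :
  loc_dist R G K <= loc_dist R G H + loc_dist R H K.
Proof.
apply: le_trans (loc_dist_ultra R H G K) _.
by rewrite ge_max lerDl lerDr !loc_dist_ge0.
Qed.

Definition mg_isob G H : bool := `[< mg_iso G H >].

Lemma mg_isob_refl : reflexive mg_isob.
Proof. by move=> G; exact/asboolP/mg_iso_refl. Qed.

Lemma mg_isob_sym : symmetric mg_isob.
Proof. by move=> G H; apply/asboolP/asboolP; exact: mg_iso_sym. Qed.

Lemma mg_isob_trans : transitive mg_isob.
Proof.
move=> H G K /asboolP GH /asboolP HK.
by apply/asboolP; exact: mg_iso_trans GH HK.
Qed.

Canonical mg_iso_rel :=
  EquivRel mg_isob mg_isob_refl mg_isob_sym mg_isob_trans.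

End isomorphism.

Lemma single_adj_conn (u v : nat) : [set 0%N] u -> [set 0%N] v ->
  exists2 p, path (fun _ _ : nat => false) u p & last u p = v.
Proof. by move=> -> ->; exists [::]. Qed.

Lemma single_adj_lf (u : nat) : finite_set [set v : nat | false].
Proof. by apply: (@sub_finite_set _ _ set0). Qed.

Definition single_vertex : lfgraph :=
  @LFGraph [set 0%N] (fun _ _ => false) (fun _ _ e => False_ind _ (notF e))
    (fun _ _ => erefl) (fun=> erefl) single_adj_lf single_adj_conn.

(* Isomorphism classes; R is the field in which the local metric takes its
   values. *)
Definition mgspace (R : realType) (k : nat) : Type := {eq_quot (@mg_iso_rel k)}.

HB.instance Definition _ R k := Choice.on (mgspace R k).
HB.instance Definition _ R k :=
  EqQuotient.copy (mgspace R k) {eq_quot (@mg_iso_rel k)}.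
HB.instance Definition _ R k := isPointed.Build (mgspace R k)
  (\pi_(mgspace R k) (@MGraph k single_vertex
     (fun=> exist _ 0%N (mem_set (erefl 0%N))))).

Section local_metric.
Variables (R : realType) (k : nat).
Implicit Types x y z : mgspace R k.

Lemma pi_mg_iso (G H : mgraph k) :
  \pi_(mgspace R k) G = \pi_(mgspace R k) H <-> mg_iso G H.
Proof.
split=> [/(@eqmodP _ (mg_iso_rel k) G H)/asboolP //|GH].
by apply/(@eqmodP _ (mg_iso_rel k) G H)/asboolP.
Qed.

Lemma repr_pi (G : mgraph k) : mg_iso (repr (\pi_(mgspace R k) G)) G.
Proof. by apply/pi_mg_iso; rewrite reprK. Qed.

Definition mgdist x y : R := loc_dist R (repr x) (repr y).

Lemma mgdist_pi (G H : mgraph k) :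
  mgdist (\pi_(mgspace R k) G) (\pi_(mgspace R k) H) = loc_dist R G H.
Proof. by apply: loc_dist_iso; exact: repr_pi. Qed.

Lemma mgdistxx x : mgdist x x = 0.
Proof. exact: loc_distxx. Qed.

Lemma mgdist_eq0 x y : mgdist x y = 0 -> x = y.
Proof. by move=> /loc_dist0/pi_mg_iso; rewrite !reprK. Qed.

Lemma mgdist_sym x y : mgdist x y = mgdist y x.
Proof. exact: loc_dist_sym. Qed.

Lemma mgdist_triangle y x z : mgdist x z <= mgdist x y + mgdist y z.
Proof. exact: loc_dist_triangle. Qed.

End local_metric.

HB.instance Definition _ (R : realType) k := isMetric.Build R (mgspace R k)
  (@mgdistxx R k) (@mgdist_eq0 R k) (@mgdist_sym R k) (@mgdist_triangle R k).

Definition mgborel (R : realType) (k : nat) :=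
  g_sigma_algebraType (@open (mgspace R k)).

Definition random_rooted_graph (R : realType) := probability (mgborel R 0) R.

(* Everything said below about a representative of an isomorphism class is
   invariant under isomorphism. *)
Definition rep (R : realType) (t : mgborel R 0) : mgraph 0 :=
  repr (t : mgspace R 0).

Definition bimark (R : realType) (G : lfgraph) (u v : vertex G) : mgborel R 1 :=
  \pi_(mgspace R 1) (@MGraph 1 G (fun i => if i == ord0 then u else v)).

Section random_graphs.
Variable R : realType.
Implicit Types (mu : random_rooted_graph R) (g : R -> R).
Local Open Scope ereal_scope.

Definition unimodular mu : Prop :=
  forall f : mgborel R 1 -> R,
    measurable_fun setT f -> (forall t, (0 <= f t)%R) ->
  \int[mu]_t (\esum_(x in [set: vertex (rep t)])
                (f (bimark R (mark (rep t) ord0) x))%:E) =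
  \int[mu]_t (\esum_(x in [set: vertex (rep t)])
                (f (bimark R x (mark (rep t) ord0)))%:E).

(* A super-additive g >= 0 has g 0 = 0, while balls of radius r < 1 have one
   element: an upper bound by C2 * g (c2 * r) near r = 0 cannot hold, whence
   the restriction to 1 <= r. *)
Definition growth_bounds g (c1 C1 c2 C2 : R) (G : lfgraph) : Prop :=
  forall v : vertex G,
    (forall r : R, (0 <= r)%R ->
      (C1 * g (c1 * r))%:E <= counting (gball G (\val v) r)) /\
    (forall r : R, (1 <= r)%R ->
      counting (gball G (\val v) r) <= (C2 * g (c2 * r))%:E).

Definition uniform_growth mu g : Prop :=
  exists c1 C1 c2 C2 : R,
    [/\ (0 < c1)%R, (0 < C1)%R, (0 < c2)%R & (0 < C2)%R] /\
    {ae mu, forall t : mgborel R 0, growth_bounds g c1 C1 c2 C2 (rep t)}.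

End random_graphs.

(* g : R -> R stands for a function on the nonnegative reals: only its values
   there matter. *)
Section growth_functions.
Variables (R : realType) (g : R -> R).

Definition strictly_increasing : Prop :=
  forall x y, 0 <= x -> x < y -> g x < g y.

Definition super_additive : Prop :=
  forall x y, 0 <= x -> 0 <= y -> g x + g y <= g (x + y).

Definition log_concave_on (D : set R) : Prop :=
  forall x y, D x -> D y -> forall a b, 0 <= a <= 1 -> 0 <= b <= 1 ->
    a + b = 1 -> a * ln (g x) + b * ln (g y) <= ln (g (a * x + b * y)).

Definition eventually_log_concave : Prop :=
  exists2 r0 : R, 0 < r0 & log_concave_on [set x | r0 <= x].

End growth_functions.

(* Main.v *)
Require Import Defs.
From HB Require Import structures.
From mathcomp Require Import all_boot all_order all_algebra.
From mathcomp Require Import all_classical all_reals all_analysis.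
From mathcomp Require Import finmap measurable_realfun zify lra.

(* Fix radices b_0, b_1, ... >= 2 and let N_n = b_0 ... b_(n-1).  A tree T_(n+1)
   on the numbers below N_(n+1) is built from b_n copies of T_n: the centers of
   the last b_n - 1 copies are joined to vertices of the first one that are as
   far as possible from its center, i.e., at distance 2^n - 1.  A ball of radius
   2 (2^k - 1) around v contains the copy of T_k to which v belongs, while a
   walk from v shorter than 2^k visits only that copy, its children, its parent
   and the children of the parent.  If the attachment vertices are spread
   evenly, a copy of T_k has O(b_k) children, so balls of radius 2^k - 1 have
   O(N_(k+1)) vertices.  Such a spreading is possible if the radices essentially
   grow at most by squaring, and log-concavity of g beyond r0 lets one choose
   them so with N_k comparable to g (r0 2^k).

   Choosing independent uniform digits, one for each level, amounts to choosing
   the position of a root in an increasing union of trees T_n; this is the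
   Benjamini-Schramm limit of the T_n.  The digits are read off a uniform real
   number x.  Mass transport holds because the translation of x by a multiple
   of 1 / N_n only changes the first n digits, i.e., moves the root inside T_n.
   All the trees of the family satisfy the ball estimates, and these are local
   properties, so they hold almost surely. *)

Set Implicit Arguments.
Unset Strict Implicit.
Unset Printing Implicit Defensive.

(** * A tree on the natural numbers in a mixed radix *)

Section digits.
Variable b : nat -> nat.
Hypothesis b_ge2 : forall n, 1 < b n.

Definition base_weight n := \prod_(l < n) b l.
Definition spare n := (b n).-1.
Local Notation N := base_weight.
Local Notation del := spare.

Lemma weightS n : N n.+1 = N n * b n.
Proof. by rewrite /N big_ord_recr. Qed.

Lemma weight0 : N 0 = 1.
Proof. by rewrite /N big_ord0. Qed.

Lemma base_gt0 n : 0 < b n.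
Proof. exact: ltnW. Qed.

Lemma weight_gt0 n : 0 < N n.
Proof. by elim: n => [|n IH]; rewrite ?weight0 // weightS muln_gt0 IH base_gt0. Qed.

Lemma weight_dvd m n : m <= n -> N m %| N n.
Proof.
move=> /subnKC <-; elim: (n - m) => [|k IH]; first by rewrite addn0.
by rewrite addnS weightS dvdn_mulr.
Qed.

Lemma weight_le m n : m <= n -> N m <= N n.
Proof. by move=> /weight_dvd; exact/dvdn_leq/weight_gt0. Qed.

Lemma ltn_weight n : n < N n.
Proof.
elim: n => [|n IH]; first exact: weight_gt0.
rewrite weightS; have := b_ge2 n; nia.
Qed.

Lemma spareE n : b n = (del n).+1.
Proof. by rewrite /del prednK // base_gt0. Qed.

Lemma spare_gt0 n : 0 < del n.
Proof. by have := b_ge2 n; rewrite spareE. Qed.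

Definition digit l i := (i %/ N l) %% b l.

Lemma ltn_digit l i : digit l i < b l.
Proof. by rewrite ltn_mod base_gt0. Qed.

Lemma digit_low l n a r : l < n -> digit l (a * N n + r) = digit l r.
Proof.
move=> ln; rewrite /digit.
have /dvdnP[c ->] := weight_dvd ln.
have -> : a * (c * N l.+1) = (a * c * b l) * N l by rewrite weightS; lia.
by rewrite divnMDl ?weight_gt0 // modnMDl.
Qed.

Lemma digit_modw l n i : l < n -> digit l i = digit l (i %% N n).
Proof. by move=> ln; rewrite {1}(divn_eq i (N n)) digit_low. Qed.

Lemma div_weight n l i i' : i %/ N n = i' %/ N n -> n <= l ->
  i %/ N l = i' %/ N l.
Proof. by move=> e /weight_dvd/dvdnP[c ->]; rewrite mulnC !divnMA e. Qed.

Lemma digit_div n l i i' : i %/ N n = i' %/ N n -> n <= l ->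
  digit l i = digit l i'.
Proof. by move=> e nl; rewrite /digit (div_weight e nl). Qed.

Lemma div_weightMD a n r : r < N n -> (a * N n + r) %/ N n = a.
Proof. by move=> rn; rewrite divnMDl ?weight_gt0 // divn_small // addn0. Qed.

Lemma digit_eq0 l i : i < N l -> digit l i = 0.
Proof. by move=> il; rewrite /digit divn_small // mod0n. Qed.

Lemma digit_top n r c : r < N n -> c < b n -> digit n (c * N n + r) = c.
Proof. by move=> rn cn; rewrite /digit div_weightMD // modn_small. Qed.

Lemma ltn_top n r c : r < N n -> c < b n -> c * N n + r < N n.+1.
Proof. rewrite weightS; nia. Qed.

Lemma div_weightS i n : i %/ N n = i %/ N n.+1 * b n + digit n i.
Proof. by rewrite weightS divnMA -divn_eq. Qed.

Lemma div_weight_digits k n i i' : k <= n -> i %/ N n = i' %/ N n ->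
  (forall l, k <= l < n -> digit l i = digit l i') -> i %/ N k = i' %/ N k.
Proof.
move=> /subnKC <-; elim: (n - k) => [|m IH]; first by rewrite addn0.
rewrite (addnS k m) => e H; apply: IH => [|l /andP[kl lm]].
  by rewrite (div_weightS i) (div_weightS i') e H // leq_addr leqnn.
by apply: H; rewrite kl ltnS ltnW.
Qed.

(** The depth of [i] in its copy of T_k, rooted at the center. A nonzero digit [l] costs 2^l: the
    depth 2^l - 1 of an attachment site, plus one edge. *)
Definition block_depth k i := \sum_(l < k) (digit l i != 0) * 2 ^ l.

Lemma block_depthS k i :
  block_depth k.+1 i = block_depth k i + (digit k i != 0) * 2 ^ k.
Proof. by rewrite /block_depth big_ord_recr. Qed.

Lemma block_depth_full k i : (forall l, l < k -> digit l i != 0) ->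
  block_depth k i = (2 ^ k).-1.
Proof.
elim: k => [|k IH] H; first by rewrite /block_depth big_ord0.
rewrite block_depthS IH; last by move=> l lk; apply: H; rewrite ltnS ltnW.
by rewrite H // expnS; have := expn_gt0 2 k; lia.
Qed.

Lemma block_depth0 k i : (forall l, l < k -> digit l i = 0) ->
  block_depth k i = 0.
Proof.
elim: k => [|k IH] H; first by rewrite /block_depth big_ord0.
rewrite block_depthS IH; last by move=> l lk; apply: H; rewrite ltnS ltnW.
by rewrite H.
Qed.

Lemma block_depth_lt k i : block_depth k i < 2 ^ k.
Proof.
elim: k => [|k IH]; first by rewrite /block_depth big_ord0.
by rewrite block_depthS expnS; case: (_ != 0); lia.
Qed.

(* The e-th attachment site of a level-n block.  Its top digit varies fastest,
   so that consecutive sites lie in different sub-blocks. *)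
Fixpoint site n e :=
  if n is n'.+1 then (e %% del n').+1 * N n' + site n' (e %/ del n') else 0.

Lemma ltn_site n e : site n e < N n.
Proof.
elim: n e => [|n IH] e /=; first by rewrite weight0.
apply: ltn_top => //; have := ltn_pmod e (spare_gt0 n).
by rewrite [b n]spareE.
Qed.

Lemma digit_site n e l : l < n -> digit l (site n e) != 0.
Proof.
elim: n e => [|n IH] e //=; rewrite ltnS leq_eqVlt => /predU1P[->|ln].
  rewrite digit_top ?ltn_site //.
  by have := ltn_pmod e (spare_gt0 n); rewrite [b n]spareE.
by rewrite digit_low // IH.
Qed.

Definition sites_per k n := \prod_(k <= l < n) del l.

(** The digits n - 1, ..., k of a site, lowered by one, are the first digits of its index [e] in the
    radices [del (n - 1)], ..., [del k], so they determine [e] modulo the product of these. *)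
Lemma site_modn k n e e' : k <= n -> site n e %/ N k = site n e' %/ N k ->
  e = e' %[mod sites_per k n].
Proof.
elim: n e e' => [|n IH] e e'.
  by rewrite leqn0 => /eqP ->; rewrite /sites_per big_geq // !modn1.
rewrite leq_eqVlt => /predU1P[->|].
  by rewrite /sites_per big_geq // !modn1.
rewrite ltnS => kn eq_site.
have top x : (x %% del n).+1 < b n.
  by have := ltn_pmod x (spare_gt0 n); rewrite [b n]spareE.
have e1 : e %% del n = e' %% del n.
  have := digit_div eq_site kn.
  by rewrite /= !digit_top ?ltn_site // => -[].
have e2 : e %/ del n = e' %/ del n %[mod sites_per k n].
  apply: IH => //; move: eq_site; rewrite /= e1.
  have /dvdnP[c ->] := weight_dvd kn.
  by rewrite mulnA !divnMDl ?weight_gt0 // => /addnI.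
rewrite /sites_per big_nat_recr //= -/(sites_per k n).
set W := sites_per k n in e2 *; set d := del n in e1 e2 *.
rewrite (divn_eq e d) (divn_eq e' d) e1.
by apply/eqP; rewrite eqn_modDr -!muln_modl eqn_mul2r e2 eqxx orbT.
Qed.

(** Here [n] is the position of the lowest nonzero digit of [i]: [i] is the center of a copy of T_n
    other than the first in its T_(n+1), and [q] is a site of the first copy. *)
Definition parent i q := exists n a j,
  [/\ i = a * N n.+1 + j.+1 * N n, j < del n & q = a * N n.+1 + site n j].

Section parent_data.
Variables (n a j : nat).
Hypothesis jn : j < del n.
Let i := a * N n.+1 + j.+1 * N n.
Let q := a * N n.+1 + site n j.

Let jb : j.+1 < b n. Proof. by rewrite [b n]spareE. Qed.

Lemma child_digit l : l < n -> digit l i = 0.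
Proof.
move=> ln; rewrite /i digit_low ?(leq_trans ln) //.
by rewrite -[_ * N n]addn0 digit_low // /digit div0n mod0n.
Qed.

Lemma child_top_digit : digit n i = j.+1.
Proof.
by rewrite /i digit_low // -[_ * N n]addn0 digit_top ?weight_gt0.
Qed.

Lemma parent_digit l : l < n -> digit l q != 0.
Proof. by move=> ln; rewrite /q digit_low ?digit_site // (leq_trans ln). Qed.

Lemma parent_top_digit : digit n q = 0.
Proof. by rewrite /q digit_low // digit_eq0 // ltn_site. Qed.

Lemma child_div : i %/ N n.+1 = a.
Proof. by rewrite /i div_weightMD // -[_ * N n]addn0 ltn_top ?weight_gt0. Qed.

Lemma parent_div : q %/ N n.+1 = a.
Proof.
by rewrite /q div_weightMD // (leq_trans (ltn_site _ _)) // weight_le.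
Qed.

End parent_data.

Lemma parent_lt i q : parent i q -> q < i.
Proof.
move=> [n [a [j [-> jn ->]]]]; rewrite ltn_add2l.
by apply: leq_trans (ltn_site _ _) _; rewrite mulSn leq_addr.
Qed.

Lemma parent_ex i : 0 < i -> exists q, parent i q.
Proof.
move=> i_gt0.
have [||n ndv max] := @ex_maxnP (fun n => N n %| i) i.
- by exists 0; rewrite weight0 dvd1n.
- by move=> n /(dvdn_leq i_gt0); apply: leq_trans; rewrite ltnW // ltn_weight.
have dn : digit n i != 0.
  apply/negP => /eqP dn0; suff /max : N n.+1 %| i by rewrite ltnn.
  have := div_weightS i n; rewrite dn0 addn0 => e.
  by rewrite -(divnK ndv) e weightS -mulnA [b n * _]mulnC dvdn_mull.
exists (i %/ N n.+1 * N n.+1 + site n (digit n i).-1), n, (i %/ N n.+1), (digit n i).-1.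
split=> //; last by have := ltn_digit n i; rewrite [b n]spareE; lia.
rewrite prednK ?lt0n // weightS -{1}(divnK ndv) (div_weightS i) weightS.
by rewrite mulnDl -mulnA [b n * _]mulnC.
Qed.

Lemma parent_level n n' a a' j j' : j < del n -> j' < del n' ->
  a * N n.+1 + j.+1 * N n = a' * N n'.+1 + j'.+1 * N n' -> n = n'.
Proof.
move=> jn jn' e; have [lt|lt|//] := ltngtP n n'.
  by have := child_digit a' j' lt; rewrite -e child_top_digit.
by have := child_digit a j lt; rewrite e child_top_digit.
Qed.

Lemma parent_uniq i q q' : parent i q -> parent i q' -> q = q'.
Proof.
move=> [n [a [j [-> jn ->]]]] [n' [a' [j' [e jn' ->]]]].
have nn' := parent_level jn jn' e; subst n'.
have aa' : a = a' by have := child_div a jn; rewrite e child_div.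
have := child_top_digit a jn; rewrite e child_top_digit // => -[->].
by rewrite aa'.
Qed.

(** If the level [n] of the edge is at least [k], the edge leads from the center of a level-[k]
    block to a deepest vertex of another one; otherwise it stays inside a block. *)
Lemma parent_cases k i q : parent i q ->
  [/\ block_depth k i = 0, block_depth k q = (2 ^ k).-1 & N k %| i] \/
  [/\ i %/ N k = q %/ N k & block_depth k i = (block_depth k q).+1].
Proof.
move=> [n [a [j [-> jn ->]]]].
have [kn|nk] := leqP k n.
  left; split.
  - by apply: block_depth0 => l lk; rewrite child_digit // (leq_trans lk).
  - by apply: block_depth_full => l lk; rewrite parent_digit // (leq_trans lk).
  - by rewrite dvdn_add // dvdn_mull // weight_dvd // ltnW.
right.
have e : (a * N n.+1 + j.+1 * N n) %/ N n.+1 = (a * N n.+1 + site n j) %/ N n.+1.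
  by rewrite child_div // parent_div.
split; first exact: div_weight e nk.
elim: k nk => // k IH; rewrite ltnS leq_eqVlt => /predU1P[nk|nk].
  subst k.
  rewrite !block_depthS child_top_digit // parent_top_digit //= addn0.
  rewrite block_depth0; last by move=> l lk; rewrite child_digit.
  rewrite block_depth_full; last by move=> l lk; rewrite parent_digit.
  by have := expn_gt0 2 n; lia.
by rewrite !block_depthS IH // (digit_div e) // addSn.
Qed.

Lemma parent_block k c i q : i < N k -> q < N k ->
  parent (c * N k + i) (c * N k + q) <-> parent i q.
Proof.
move=> ik qk.
have lift q' : parent i q' -> parent (c * N k + i) (c * N k + q').
  move=> [n [a [j [ei jn ->]]]].
  have nk : n < k.
    rewrite ltnNge; apply/negP => /weight_le kn.
    suff : N n <= i by lia.
    rewrite ei; nia.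
  have /dvdnP[c' ->] := weight_dvd nk.
  by exists n, (c * c' + a), j; rewrite ei; split=> //; lia.
split=> [P|]; last exact: lift.
have i_gt0 : 0 < i by have := parent_lt P; lia.
have [q' Pq'] := parent_ex i_gt0.
by have /addnI <- := parent_uniq (lift _ Pq') P.
Qed.

(* All the children of a level-k block are attached at the same level, the
   first one >= k where the digit of the block is 0; the position of the block
   then determines the index of the site modulo [sites_per k n]. *)
Lemma child_block_inj k e e' n a j n' a' j' :
  k <= n -> j < del n -> k <= n' -> j' < del n' ->
  e * N k = a * N n.+1 + j.+1 * N n -> e' * N k = a' * N n'.+1 + j'.+1 * N n' ->
  (a * N n.+1 + site n j) %/ N k = (a' * N n'.+1 + site n' j') %/ N k ->
  j %/ sites_per k n = j' %/ sites_per k n' -> e = e'.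
Proof.
move=> kn jn kn' jn' ee ee' eqk eqs.
have nn' : n = n'.
  have [lt|lt|//] := ltngtP n n'.
    by have := parent_digit a' j' lt; rewrite -(digit_div eqk) // parent_top_digit.
  by have := parent_digit a j lt; rewrite (digit_div eqk) // parent_top_digit.
subst n'.
have aa' : a = a'.
  rewrite -(parent_div n a j) -(parent_div n a' j').
  by apply: div_weight eqk _; rewrite (leq_trans kn).
subst a'.
have : j = j' %[mod sites_per k n].
  apply: site_modn => //; move: eqk.
  have /dvdnP[c ->] := weight_dvd (leq_trans kn (leqnSn n)).
  by rewrite mulnA !divnMDl ?weight_gt0 // => /addnI.
move=> eqm; have jj' : j = j'.
  by rewrite (divn_eq j (sites_per k n)) eqm eqs -divn_eq.
apply/eqP; rewrite -(eqn_pmul2r (weight_gt0 k)) ee ee' jj'; exact/eqP.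
Qed.

Lemma sites_per_gt0 k n : 0 < sites_per k n.
Proof. by apply: prodn_gt0 => l; exact: spare_gt0. Qed.

Lemma sites_perS k n : k <= n -> sites_per k n.+1 = sites_per k n * del n.
Proof. by move=> kn; rewrite /sites_per big_nat_recr. Qed.

(** * Adjacency and acyclicity *)

Definition tree_adj : rel nat := fun u v => `[< parent u v \/ parent v u >].

Lemma tree_adjP u v : reflect (parent u v \/ parent v u) (tree_adj u v).
Proof. exact: asboolP. Qed.

Lemma tree_adj_sym : symmetric tree_adj.
Proof. by move=> u v; apply/tree_adjP/tree_adjP => -[]; [right|left|right|left]. Qed.

Lemma tree_adj_irr : irreflexive tree_adj.
Proof. by move=> u; apply/tree_adjP => -[]/parent_lt; rewrite ltnn. Qed.

Lemma tree_adj_block k c i q : i < N k -> q < N k ->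
  tree_adj (c * N k + i) (c * N k + q) = tree_adj i q.
Proof. by move=> ik qk; apply/tree_adjP/tree_adjP; rewrite !parent_block. Qed.

(* The largest vertex of a cycle would have two distinct parents. *)
Lemma tree_adj_acyclic c : ucycle tree_adj c -> size c < 3.
Proof.
move=> /andP[cc uc]; rewrite ltnNge; apply/negP => sc.
have [x xc xmax] : exists2 x, x \in c & forall y, y \in c -> y <= x.
  have ex : exists x, x \in c by case: (c) sc => // x c' _; exists x; rewrite inE eqxx.
  have [y yc|x xc xmax] := @ex_maxnP (fun x => x \in c) (\max_(y <- c) y) ex.
    exact: (@leq_bigmax_seq _ _ xpredT id).
  by exists x.
have [n c' rc] := rot_to xc.
have uc' : uniq (x :: c') by rewrite -rc rot_uniq.
have {}cc : cycle tree_adj (x :: c') by rewrite -rc rot_cycle.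
have max y : y \in x :: c' -> y <= x by rewrite -rc mem_rot; exact: xmax.
have sc' : 2 < size (x :: c') by rewrite -rc size_rot.
have dn y : y \in c' -> tree_adj x y -> parent x y.
  move=> yc /tree_adjP[//|/parent_lt]; have := max y.
  by rewrite inE yc orbT => /(_ isT); lia.
case: c' cc uc' {rc} sc' max dn => [//|y c'].
case/lastP: c' => [//|c' z] /= /andP[xy].
rewrite -rcons_cons rcons_path last_rcons mem_rcons !inE => /andP[_ zx].
move=> /and3P[_ + _] _ _ dn.
suff -> : y = z by rewrite mem_rcons inE eqxx.
by apply: (@parent_uniq x); apply: dn;
  rewrite ?mem_rcons ?inE ?eqxx ?orbT // tree_adj_sym.
Qed.

(** * Walks inside and between blocks *)

Lemma block_center_path k i : exists p,
  [/\ path tree_adj i p, last i p = i %/ N k * N k, size p <= block_depth k i &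
      all (fun x => x %/ N k == i %/ N k) p].
Proof.
move: {2}(block_depth k i) (leqnn (block_depth k i)) => t.
elim: t i => [|t IH] i it; have [/eqP e|ne] := boolP (i %/ N k * N k == i).
- by exists [::].
- have i_gt0 : 0 < i by case: (i) ne => //; rewrite div0n.
  have [q /(parent_cases k)[[_ _]|[_ e]]] := parent_ex i_gt0; last by lia.
  by move=> /divnK/eqP; rewrite (negPf ne).
- by exists [::].
- have i_gt0 : 0 < i by case: (i) ne => //; rewrite div0n.
  have [q Pq] := parent_ex i_gt0.
  have [[_ _]|[eb e]] := parent_cases k Pq.
    by move=> /divnK/eqP; rewrite (negPf ne).
  have [|p [pp lp sp ap]] := IH q; first by lia.
  exists (q :: p); rewrite /= pp lp eb ap eqxx e; split=> //.
  by rewrite andbT; apply/tree_adjP; left.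
Qed.

Lemma block_path k i i' : i %/ N k = i' %/ N k -> exists p,
  [/\ path tree_adj i p, last i p = i', size p <= 2 * (2 ^ k).-1 &
      all (fun x => x %/ N k == i %/ N k) p].
Proof.
move=> e; have [p [pp lp sp ap]] := block_center_path k i.
have [q [pq lq sq aq]] := block_center_path k i'.
exists (p ++ rev (belast i' q)); split.
- rewrite cat_path pp /= lp e -lq rev_path.
  by rewrite (eq_path (e' := tree_adj)) // => x y; rewrite tree_adj_sym.
- rewrite last_cat lp e -lq; case: (q) => //= x q'.
  by rewrite rev_cons last_rcons.
- rewrite size_cat size_rev size_belast.
  by have := block_depth_lt k i; have := block_depth_lt k i'; lia.
- rewrite all_cat ap all_rev; have : all (fun x => x %/ N k == i %/ N k) (i' :: q).
    by rewrite /= e eqxx.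
  by rewrite lastI all_rcons => /andP[].
Qed.

Definition child_block k e c := exists2 q, parent (e * N k) q & q %/ N k = c.

Lemma child_block_uniq k e c c' : child_block k e c -> child_block k e c' -> c = c'.
Proof. by move=> [q Pq <-] [q' Pq' <-]; rewrite (parent_uniq Pq Pq'). Qed.

Lemma tree_adj_cases k u v : tree_adj u v ->
  [\/ [/\ u %/ N k = v %/ N k, block_depth k v <= (block_depth k u).+1 &
          block_depth k u <= (block_depth k v).+1],
      [/\ child_block k (u %/ N k) (v %/ N k), block_depth k u = 0 &
          block_depth k v = (2 ^ k).-1] |
      [/\ child_block k (v %/ N k) (u %/ N k), block_depth k v = 0 &
          block_depth k u = (2 ^ k).-1] ].
Proof.
move=> /tree_adjP[] P; have [[e0 ef dv]|[eb e]] := parent_cases k P.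
- by apply: Or32; split=> //; exists v => //; rewrite divnK.
- by apply: Or31; split=> //; lia.
- by apply: Or33; split=> //; exists u => //; rewrite divnK.
- by apply: Or31; split=> //; lia.
Qed.

Definition near_block k u w := [\/ w %/ N k = u %/ N k,
  child_block k (w %/ N k) (u %/ N k), child_block k (u %/ N k) (w %/ N k) |
  exists2 c, child_block k (u %/ N k) c & child_block k (w %/ N k) c].

(* Inside a block, the center and the attachment sites are at distance
   2 ^ k - 1; so a shorter walk cannot pass from a site to the center or back,
   except in the block where it starts. *)
Lemma short_walk_near k u p : path tree_adj u p -> size p < 2 ^ k ->
  near_block k u (last u p).
Proof.
move=> pp sp; set D := block_depth k; set B := fun w => w %/ N k.
(* A child or sibling block is entered at its center, so the depth there stays below the number of
   steps; the parent block is entered at depth 2^k - 1, so its center stays out of reach. *)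
suff [?|[? _]|[? _]|[c [? ? _]]] : [\/ B (last u p) = B u,
    child_block k (B (last u p)) (B u) /\ D (last u p) < size p,
    child_block k (B u) (B (last u p)) /\ 2 ^ k <= D (last u p) + size p |
    exists c, [/\ child_block k (B u) c, child_block k (B (last u p)) c &
                  D (last u p) < size p] ].
- exact: Or41.
- exact: Or42.
- exact: Or43.
- by apply: Or44; exists c.
have k_gt0 := expn_gt0 2 k.
elim/last_ind: p pp sp => [|p w IH]; first by move=> _ _; apply: Or41.
rewrite rcons_path last_rcons size_rcons => /andP[pp pw] sp.
have {IH pp} := IH pp (ltnW sp); move: (last u p) pw => x xw.
have := tree_adj_cases k xw; rewrite -/(D x) -/(D w) -/(B x) -/(B w).
case=> [[eB D1 D2]|[cB Dx Dw]|[cB Dw Dx]].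
- rewrite eB => -[?|[? ?]|[? ?]|[c [? ? ?]]].
  + exact: Or41.
  + by apply: Or42; split=> //; lia.
  + by apply: Or43; split=> //; lia.
  + by apply: Or44; exists c; split=> //; lia.
- move=> [e|[c1 ?]|[? ?]|[c [c0 c1 ?]]].
  + by apply: Or43; rewrite -e; split=> //; lia.
  + by apply: Or41; exact: child_block_uniq cB c1.
  + by lia.
  + by apply: Or43; rewrite (child_block_uniq cB c1); split=> //; lia.
- move=> [e|[? ?]|[c0 ?]|[c [? ? ?]]].
  + by apply: Or42; rewrite -e; split=> //; lia.
  + by lia.
  + by apply: Or44; exists (B x); split=> //; lia.
  + by lia.
Qed.

(** * Counting the ends of short walks *)

Section slow_growth.
Hypothesis spare_growth : forall n, del n.+1 <= (del n + 2) ^ 2.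

(* If del n >= 3 then (del n + 2) ^ 2 + 8 <= (del n + 8) * del n, so that del + 8
   grows at most like the number of sites; otherwise del n.+1 + 8 <= 24. *)
Lemma spare_le_sites k n : k <= n -> del n + 8 <= 24 * del k * sites_per k n.
Proof.
move=> /subnKC <-; elim: (n - k) => [|m IH].
  by rewrite addn0 /sites_per big_geq // muln1; have := spare_gt0 k; lia.
rewrite (addnS k m) sites_perS ?leq_addr //.
have := spare_growth (k + m); move: (del (k + m)) (spare_gt0 (k + m)) IH => d d0 IH le.
have := sites_per_gt0 k (k + m); have := spare_gt0 k.
move: (del _.+1) (sites_per _ _) (del k) le IH => d' W e le IH e0 W0.
have [d3|d2] := leqP 3 d; nia.
Qed.

(** The index is the number of full rounds that the enumeration of sites has made through the
    level-[k] sub-blocks. As [j < del n], it is bounded by [spare_le_sites]. *)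
Lemma child_block_index k : exists idx : nat -> nat, forall c e,
  child_block k e c -> idx e < 24 * del k /\
  forall e', child_block k e' c -> idx e = idx e' -> e = e'.
Proof.
pose ok e t := exists n a j, [/\ k <= n, j < del n,
  e * N k = a * N n.+1 + j.+1 * N n & t = j %/ sites_per k n].
have /choice[idx idxP] : forall e, exists t, (exists c, child_block k e c) -> ok e t.
  move=> e.
  have [[c [q [n [a [j [ei jn _]]]] _]]|no] := pselect (exists c, child_block k e c).
    exists (j %/ sites_per k n) => _; exists n, a, j; split=> //.
    rewrite leqNgt; apply/negP => nk; have := child_top_digit a jn.
    rewrite -ei -[_ * N k]addn0 digit_low //.
    by rewrite /digit div0n mod0n.
  by exists 0.
exists idx => c e ec.
have [n [a [j [kn jn ei ti]]]] := idxP e (ex_intro _ c ec).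
split.
  rewrite ti ltn_divLR ?sites_per_gt0 //.
  by have := spare_le_sites kn; lia.
move=> e' ec'; have [n' [a' [j' [kn' jn' ei' ti']]]] := idxP e' (ex_intro _ c ec').
rewrite ti ti'; apply: (child_block_inj kn jn kn' jn' ei ei').
move: ec ec' => [q Pq eq] [q' Pq' eq'].
have -> : a * N n.+1 + site n j = q by apply: parent_uniq Pq; exists n, a, j.
have -> : a' * N n'.+1 + site n' j' = q'.
  by apply: parent_uniq Pq'; exists n', a', j'.
by rewrite eq eq'.
Qed.

(** The walks end in the block [c0] of [u], its parent [c1], or a child of one of these: at most 2 +
    48 [del k] blocks, each with [N k] vertices. *)
Lemma short_walks_count k u s : uniq s ->
  (forall w, w \in s -> exists p,
    [/\ path tree_adj u p, last u p = w & size p < 2 ^ k]) ->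
  size s <= 50 * N k.+1.
Proof.
move=> us H; set B := fun w => w %/ N k; set c0 := B u.
(* [c1] is a dummy value if [c0] has no parent block. *)
have [c1 c1P] : exists c1, forall c, child_block k c0 c -> c = c1.
  have [[c c0c]|no] := pselect (exists c, child_block k c0 c).
    by exists c => c' /child_block_uniq; apply.
  by exists 0 => c c0c; case: no; exists c.
have [idx idxP] := child_block_index k.
set K := 24 * del k in idxP.
pose tag e := if e == c0 then 0 else if e == c1 then 1 else
  if `[< child_block k e c0 >] then 2 + idx e else 2 + K + idx e.
have near w : w \in s -> [\/ B w = c0, B w = c1, child_block k (B w) c0 |
                             child_block k (B w) c1].
  move=> /H[p [pp <- sp]].
  case: (short_walk_near pp sp) => [?|?|/c1P ?|[c /c1P -> ?]].
  - exact: Or41.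
  - exact: Or43.
  - exact: Or42.
  - exact: Or44.
have tag_lt w : w \in s -> tag (B w) < 2 + 2 * K.
  move=> /near; rewrite /tag; case: eqP => // n0; case: eqP => // n1.
  case: asboolP => [/idxP[? _] _|nc]; first by lia.
  by case=> // /idxP[? _]; lia.
have tag_inj w w' : w \in s -> w' \in s -> tag (B w) = tag (B w') -> B w = B w'.
  move=> /near + /near; rewrite /tag.
  case: eqP => [->|n0]; case: eqP => [->|n0'] //; do ?[case: eqP => [->|n1] //];
    do ?[case: eqP => [->|n1'] //]; do ?case: asboolP => //.
  - by move=> c' c _ _ /addnI; have [_ ] := idxP _ _ c; exact.
  - by move=> ? /idxP[? _] _ _; lia.
  - by move=> /idxP[? _] ? _ _; lia.
  - move=> nc' nc; case=> // c; case=> // c' /addnI.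
    by have [_ ] := idxP _ _ c; exact.
pose code w := tag (B w) * N k + w %% N k.
have ucode : uniq (map code s).
  rewrite map_inj_in_uniq // => w w' ws w's e.
  have eB : B w = B w'.
    apply: tag_inj => //; move: (congr1 (fun x => x %/ N k) e).
    by rewrite /= !div_weightMD ?ltn_mod ?weight_gt0.
  move: e; rewrite /code eB => /addnI e.
  by rewrite (divn_eq w (N k)) (divn_eq w' (N k)) e -/(B w) eB.
rewrite -(size_map code); apply: (@leq_trans (size (iota 0 ((2 + 2 * K) * N k)))).
  apply: uniq_leq_size => // x /mapP[w ws ->]; rewrite mem_iota /= add0n.
  have := tag_lt _ ws; have : w %% N k < N k by rewrite ltn_mod weight_gt0.
  by rewrite /code; nia.
rewrite size_iota weightS spareE /K; have := spare_gt0 k; nia.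
Qed.
End slow_growth.

(** * Digit shifts without carry *)

Definition shift_digit m c i :=
  i %/ N m.+1 * N m.+1 + ((digit m i + c) %% b m * N m + i %% N m).

Let shift_digit_lt m c i : (digit m i + c) %% b m * N m + i %% N m < N m.+1.
Proof. by apply: ltn_top; rewrite ltn_mod ?weight_gt0 ?base_gt0. Qed.

Lemma shift_digit_div m c i l : m < l -> shift_digit m c i %/ N l = i %/ N l.
Proof. by apply: div_weight; rewrite /shift_digit div_weightMD. Qed.

Lemma shift_digit_mod m c i : shift_digit m c i %% N m = i %% N m.
Proof.
by rewrite /shift_digit weightS [N m * _]mulnC mulnA addnA -mulnDl modnMDl modn_mod.
Qed.

Lemma shift_digit_top m c i : digit m (shift_digit m c i) = (digit m i + c) %% b m.
Proof.
by rewrite /shift_digit digit_low // digit_top // ltn_mod ?weight_gt0 ?base_gt0.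
Qed.

Lemma shift_digitD m c c' i :
  shift_digit m c' (shift_digit m c i) = shift_digit m (c + c') i.
Proof.
rewrite {1}/shift_digit shift_digit_div // shift_digit_mod shift_digit_top.
by rewrite modnDml -addnA.
Qed.

Lemma shift_digit0 m c i : b m %| c -> shift_digit m c i = i.
Proof.
move=> /dvdnP[c' ->]; rewrite /shift_digit [digit m i + _]addnC modnMDl.
rewrite modn_small ?ltn_digit // [RHS](divn_eq i (N m)) (div_weightS i m) weightS.
lia.
Qed.

Fixpoint twist (d : nat -> nat) m i :=
  if m is m'.+1 then shift_digit m' (d m') (twist d m' i) else i.

Lemma twist_div d m l i : m <= l -> twist d m i %/ N l = i %/ N l.
Proof.
elim: m i => //= m IH i ml.
by rewrite shift_digit_div // IH // ltnW.
Qed.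

Lemma ltn_divw l i : (i < N l) = (i %/ N l == 0).
Proof.
apply/idP/eqP => [/divn_small //|e].
by rewrite (divn_eq i (N l)) e ltn_mod weight_gt0.
Qed.

Lemma ltn_twist d m l i : m <= l -> (twist d m i < N l) = (i < N l).
Proof. by move=> ml; rewrite !ltn_divw twist_div. Qed.

Lemma twistS d m i : i < N m -> twist d m.+1 i = d m %% b m * N m + twist d m i.
Proof.
move=> im; have tm : twist d m i < N m by rewrite ltn_twist.
rewrite /= /shift_digit digit_eq0 // add0n (modn_small tm).
by rewrite divn_small ?mul0n // (leq_trans tm) // weight_le.
Qed.

Let neg_digit m c : b m %| c + (b m - c %% b m).
Proof.
have := divn_eq c (b m); have := ltn_pmod c (base_gt0 m) => lt e.
by apply/dvdnP; exists (c %/ b m).+1; lia.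
Qed.

Lemma shift_digitK m c : cancel (shift_digit m c) (shift_digit m (b m - c %% b m)).
Proof. by move=> i; rewrite shift_digitD shift_digit0 // neg_digit. Qed.

Lemma shift_digitVK m c : cancel (shift_digit m (b m - c %% b m)) (shift_digit m c).
Proof. by move=> i; rewrite shift_digitD shift_digit0 // addnC neg_digit. Qed.

Lemma twist_inj d m : injective (twist d m).
Proof.
elim: m => [|m IH] i i' //= e; apply: IH.
by rewrite -[LHS](shift_digitK m (d m)) e shift_digitK.
Qed.

Lemma twist_surj d m i : exists i', twist d m i' = i.
Proof.
elim: m i => [|m IH] i /=; first by exists i.
have [i' e] := IH (shift_digit m (b m - d m %% b m) i).
by exists i'; rewrite e shift_digitVK.
Qed.

Lemma digit_twist d m l i : l < m ->
  digit l (twist d m i) = (digit l i + d l) %% b l.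
Proof.
elim: m => // m IH; rewrite ltnS leq_eqVlt => /predU1P[->|lm] /=.
  by rewrite shift_digit_top (digit_div (twist_div d i (leqnn m))).
by rewrite [LHS](digit_modw _ lm) shift_digit_mod -digit_modw // IH.
Qed.

(** Without carries, the digits from [k] on of the image depend only on those of the argument, so
    blocks go to blocks. *)
Lemma twist_div_eq d m k i i' : i %/ N k = i' %/ N k ->
  twist d m i %/ N k = twist d m i' %/ N k.
Proof.
move=> e; have [mk|km] := leqP m k; first by rewrite !twist_div.
apply: (@div_weight_digits k m) => [||l /andP[kl lm]]; first exact: ltnW.
  by rewrite !twist_div // (div_weight e) // ltnW.
by rewrite !digit_twist // (digit_div e kl).
Qed.

Lemma eq_twist d d' m i : (forall l, l < m -> d l = d' l) ->
  twist d m i = twist d' m i.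
Proof.
elim: m => //= m IH e; rewrite e // IH // => l lm.
by apply: e; rewrite ltnS ltnW.
Qed.

Lemma twist_id d m i : (forall l, l < m -> d l = 0) -> twist d m i = i.
Proof.
elim: m => //= m IH e; rewrite e // shift_digit0 // IH // => l lm.
by apply: e; rewrite ltnS ltnW.
Qed.

Lemma twist_twist d d' m m' i : m <= m' -> (forall l, l < m -> d' l = 0) ->
  (forall l, m <= l -> d' l = d l) -> twist d' m' (twist d m i) = twist d m' i.
Proof.
move=> + lo hi; elim: m' => [|m' IH].
  by rewrite leqn0 => /eqP ->.
rewrite leq_eqVlt => /predU1P[e|mm']; first by rewrite -e twist_id.
by rewrite /= hi // IH.
Qed.
End digits.

Import Order.TTheory GRing.Theory Num.Theory.
Local Open Scope classical_set_scope.
Local Open Scope ring_scope.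
Local Open Scope quotient_scope.

(** * Radices adapted to the growth function *)

(** Each radix is the truncated ratio of consecutive terms, plus one whenever [a 0 * N_n] lags
    behind [a n]; this correction keeps the two within a factor 2. *)
Lemma bases_of_ratios (R : realType) (a : nat -> R) :
  (forall n, 0 < a n) -> (forall n, 2 * a n <= a n.+1) ->
  (forall n, a n.+2 / a n.+1 <= (a n.+1 / a n) ^+ 2) ->
  exists b : nat -> nat, [/\ forall n, (1 < b n)%N,
    forall n, (spare b n.+1 <= (spare b n + 2) ^ 2)%N &
    forall n, a n <= 2 * a 0%N * (base_weight b n)%:R /\
              a 0%N * (base_weight b n)%:R <= 2 * a n].
Proof.
move=> a_gt0 a_dbl a_ratio.
pose G n := a n.+1 / a n.
have G_ge2 n : 2 <= G n by rewrite ler_pdivlMr.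
have G_ge0 n : 0 <= G n by rewrite (le_trans _ (G_ge2 n)).
pose base n w := (Num.truncn (G n) + ((a 0%N * w%:R < a n)%R : nat))%N.
pose fix W n := if n is n'.+1 then (W n' * base n' (W n'))%N else 1%N.
pose b n := base n (W n).
have WE n : base_weight b n = W n.
  by elim: n => [|n IH]; [rewrite weight0|rewrite weightS IH].
have tr_ge2 n : (2 <= Num.truncn (G n))%N by rewrite truncn_ge_nat.
have tr_le n : (Num.truncn (G n))%:R <= G n.
  by rewrite truncn_le.
have tr_gt n : G n < (Num.truncn (G n)).+1%:R.
  by rewrite -truncn_lt_nat.
exists b; split=> [n|n|n].
- by rewrite (leq_trans (tr_ge2 n)) // leq_addr.
- have : (spare b n.+1 <= Num.truncn (G n.+1))%N.
    by rewrite /spare /b /base; case: (_ < _); lia.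
  move=> /leq_trans; apply.
  (* So [spare b n + 2] exceeds [G n], whose square bounds the next ratio. *)
  have : ((Num.truncn (G n)).+1 <= spare b n + 2)%N.
    by rewrite /spare /b /base; have := tr_ge2 n; lia.
  rewrite -(@ler_nat R) => le.
  rewrite -(@ler_nat R) (le_trans (tr_le _)) // (le_trans (a_ratio n)) //.
  by rewrite natrX ler_pXn2r ?nnegrE // ?G_ge0 // (le_trans (ltW (tr_gt n))).
rewrite WE; elim: n => [|n [IH1 IH2]] /=.
  by have := a_gt0 0%N; rewrite mulr1; split; lra.
have aG : a n.+1 = G n * a n by rewrite /G divfK // gt_eqF.
have := tr_ge2 n; rewrite -(@ler_nat R) aG natrM /base -[2 * _ * _]mulrA.
rewrite [a 0%N * (_ * _)]mulrA.
rewrite -[2 * _ * _]mulrA in IH1.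
have := tr_le n; have := tr_gt n; have := a_gt0 n; rewrite -natr1.
case: (ltP (a 0%N * (W n)%:R) (a n)); rewrite ?addn0 ?addn1 -?natr1;
  move: (a 0%N * (W n)%:R) IH1 IH2;
  move: (a n) (G n) (Num.truncn _)%:R => A g t x IH1 IH2 xA A0 gt tg t2; split.
- have : 0 <= (2 * x - A) * (t + 1) by apply: mulr_ge0; lra.
  have : 0 <= A * (t + 1 - g) by apply: mulr_ge0; lra.
  by nra.
- have : 0 <= (A - x) * (t + 1) by apply: mulr_ge0; lra.
  have : 0 <= A * (2 * g - (t + 1)) by apply: mulr_ge0; lra.
  by nra.
- have : 0 <= (x - A) * t by apply: mulr_ge0; lra.
  have : 0 <= A * (2 * t - g) by apply: mulr_ge0; lra.
  by nra.
- have : 0 <= (2 * A - x) * t by apply: mulr_ge0; lra.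
  have : 0 <= A * (g - t) by apply: mulr_ge0; lra.
  by nra.
Qed.

Lemma growth_bases (R : realType) (g : R -> R) :
  (forall x : R, 0 <= x -> 0 <= g x) -> strictly_increasing g ->
  super_additive g -> eventually_log_concave g ->
  exists r0 : R, 0 < r0 /\ 0 < g r0 /\ exists b : nat -> nat,
   [/\ forall n, (1 < b n)%N,
    forall n, (spare b n.+1 <= (spare b n + 2) ^ 2)%N &
    forall n, g (r0 * 2 ^+ n) <= 2 * g r0 * (base_weight b n)%:R /\
              g r0 * (base_weight b n)%:R <= 2 * g (r0 * 2 ^+ n)].
Proof.
move=> g0 gi gs [r0 r0_gt0 gl]; exists r0; split=> //.
pose a n := g (r0 * 2 ^+ n).
have p2 n : 0 < (2 : R) ^+ n by rewrite exprn_gt0.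
have a_gt0 n : 0 < a n.
  by rewrite (le_lt_trans (g0 0 (lexx 0))) // gi // mulr_gt0.
have g0E : g r0 = a 0%N by rewrite /a expr0 mulr1.
split; first by rewrite g0E.
rewrite g0E; apply: (@bases_of_ratios _ a) => // n.
  rewrite /a exprS mulrCA mulrDl mul1r mulrDl mul1r.
  by apply: gs; rewrite ltW // mulr_gt0.
(* As 4/3 + 2/3 = 2, these weights give a_(n+2) a_n^2 <= a_(n+1)^3: each ratio is at most the square
   of the previous one. *)
have := gl (r0 * 2 ^+ n.+2) (r0 * 2 ^+ n) _ _ 3^-1 (2 / 3).
have ge_r0 m : r0 <= r0 * 2 ^+ m.
  by apply: ler_peMr; [exact: ltW|rewrite exprn_ege1 // ler1n].
move=> /(_ (ge_r0 _) (ge_r0 _)).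
have h : 0 <= (3^-1 : R) <= 1 by lra.
have h' : 0 <= (2 / 3 : R) <= 1 by lra.
move=> /(_ h h'); have -> : 3^-1 + 2 / 3 = 1 :> R by lra.
move=> /(_ erefl).
have -> : 3^-1 * (r0 * 2 ^+ n.+2) + 2 / 3 * (r0 * 2 ^+ n) = r0 * 2 ^+ n.+1.
  by rewrite !exprS; lra.
rewrite -/(a n) -/(a n.+1) -/(a n.+2) => le.
rewrite -ler_ln ?posrE ?divr_gt0 ?exprn_gt0 ?divr_gt0 //.
by rewrite lnXn ?divr_gt0 // !ln_div ?posrE // -mulr_natl; lra.
Qed.

(** * Twisted trees *)

(* The tree seen from a root with digits d 0, d 1, ...: the label k stands for the
   vertex whose digits are those of k shifted by d, so that the root is 0.  S is
   the set of the levels n for which T_n is included: setT for the infinite tree,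
   a singleton for a finite one. *)
Section twisted_trees.
Local Open Scope nat_scope.
Variable b : nat -> nat.
Hypothesis b_ge2 : forall n, 1 < b n.
Hypothesis spare_growth : forall n, spare b n.+1 <= (spare b n + 2) ^ 2.
Local Notation N := (base_weight b).

(** On labels below [N m], the further twists only add a common multiple of [N m], and such
    translations preserve adjacency. *)
Lemma tree_adj_twist d m M k l : m <= M -> k < N m -> l < N m ->
  tree_adj b (twist b d M k) (twist b d M l) =
  tree_adj b (twist b d m k) (twist b d m l).
Proof.
move=> /subnKC <- km lm; elim: (M - m) => [|j IH]; first by rewrite addn0.
have lt x : x < N m -> x < N (m + j).
  by move=> /leq_trans; apply; rewrite weight_le ?leq_addr.
by rewrite (addnS m j) !twistS ?lt // tree_adj_block ?ltn_twist ?lt.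
Qed.

Variables (S : set nat) (d : nat -> nat).

Definition tvtx : set nat := [set k | exists2 m, S m & k < N m].

(** Infinitely many shifted digits need not form a natural number, so adjacency is read at a finite
    level; by [tree_adj_twist] the choice of level does not matter. *)
Definition tadj : rel nat := fun k l => `[< exists m,
  [/\ S m, k < N m, l < N m & tree_adj b (twist b d m k) (twist b d m l)] >].

Lemma tadj_at m k l : S m -> k < N m -> l < N m ->
  tadj k l = tree_adj b (twist b d m k) (twist b d m l).
Proof.
move=> Sm km lm; apply/asboolP/idP => [[m' [Sm' km' lm']]|]; last by exists m.
by case/orP: (leq_total m m') => mm'; rewrite (tree_adj_twist _ mm').
Qed.

Lemma tadj_tree_adj k l : tadj k l ->
  exists m0, forall M, m0 <= M -> tree_adj b (twist b d M k) (twist b d M l).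
Proof.
by move=> /asboolP[m [Sm km lm a]]; exists m => M mM; rewrite (tree_adj_twist _ mM).
Qed.

Lemma tpath_tree_path k p : path tadj k p -> exists m0, forall M, m0 <= M ->
  path (tree_adj b) (twist b d M k) (map (twist b d M) p).
Proof.
elim: p k => [|l p IH] k /=; first by exists 0.
move=> /andP[/tadj_tree_adj[m1 H1] /IH[m2 H2]]; exists (maxn m1 m2) => M.
by rewrite geq_max => /andP[/H1 -> /H2].
Qed.

Lemma tree_path_tpath m k q : S m -> k < N m -> all (fun x => x < N m) q ->
  path (tree_adj b) (twist b d m k) q ->
  exists p, [/\ path tadj k p, map (twist b d m) p = q & all (fun x => x < N m) p].
Proof.
move=> Sm; elim: q k => [|x q IH] k km /=; first by exists [::].
move=> /andP[xm aq] /andP[kx pq].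
have [y ey] := twist_surj b_ge2 d m x; rewrite -ey in xm kx pq *.
rewrite ltn_twist // in xm.
have [p [pp <- ap]] := IH y xm aq pq.
by exists (y :: p); rewrite /= pp ap xm (tadj_at Sm) ?kx.
Qed.

(** For finitely many walks, one injective [twist b d M] carries them all into [tree_adj], where
    [short_walks_count] applies. *)
Lemma tball_count k u s : uniq s ->
  (forall w, w \in s -> exists p,
    [/\ path tadj u p, last u p = w & size p < 2 ^ k]) ->
  size s <= 50 * N k.+1.
Proof.
move=> us H.
have [M HM] : exists M, forall w, w \in s -> forall M', M <= M' -> exists p,
    [/\ path (tree_adj b) (twist b d M' u) p, last (twist b d M' u) p = twist b d M' w &
        size p < 2 ^ k].
  elim: s {us} H => [|w s IH] H; first by exists 0.
  have [|M1 H1] := IH; first by move=> x xs; apply: H; rewrite inE xs orbT.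
  have [|p [/tpath_tree_path[M2 H2] lp sp]] := H w; first by rewrite inE eqxx.
  exists (maxn M1 M2) => x.
  rewrite inE => /predU1P[->|xs] M'; rewrite geq_max => /andP[le1 le2].
    by exists (map (twist b d M') p); rewrite H2 // last_map lp size_map.
  exact: H1.
rewrite -(size_map (twist b d M)).
apply: (@short_walks_count b b_ge2 spare_growth k (twist b d M u)).
  by rewrite map_inj_uniq //; exact: twist_inj.
by move=> _ /mapP[w ws ->]; exact: HM.
Qed.

(** The walk of [block_path] between the twisted ends stays in one block, hence below [N m], and
    lifts back through the twist. *)
Lemma tblock_path m k v w : S m -> k <= m -> v < N m -> v %/ N k = w %/ N k ->
  exists p, [/\ path tadj v p, last v p = w & size p <= 2 * (2 ^ k).-1].
Proof.
move=> Sm km vm e.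
have [|q [pq lq sq aq]] := @block_path b b_ge2 k (twist b d m v) (twist b d m w).
  exact: twist_div_eq.
have : all (fun x => x < N m) q.
  apply: sub_all aq => x /eqP ex; rewrite ltn_divw //.
  by rewrite (div_weight ex km) twist_div // divn_small.
move=> /(tree_path_tpath Sm vm)/(_ pq)[p [pp ep _]].
exists p; split=> //; last by rewrite -(size_map (twist b d m)) ep.
by apply: (@twist_inj b b_ge2 d m); rewrite -last_map ep.
Qed.

Lemma tadj_sym : symmetric tadj.
Proof.
by move=> k l; apply/asboolP/asboolP => -[m [? ? ? a]]; exists m; rewrite tree_adj_sym.
Qed.

Lemma tadj_irr : irreflexive tadj.
Proof. by move=> k; apply/asboolP => -[m [_ _ _]]; rewrite tree_adj_irr. Qed.

Lemma tadj_vtx k l : tadj k l -> tvtx k.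
Proof. by move=> /asboolP[m [Sm km _ _]]; exists m. Qed.

Lemma finite_of_bounded (A : set nat) K :
  (forall s, uniq s -> (forall x, x \in s -> A x) -> size s <= K) -> finite_set A.
Proof.
move=> H; apply: contrapT => /(infinite_set_fset K.+1)[B BA].
by rewrite ltnNge => /negP; apply; apply: H => [|x xB]; [exact: fset_uniq|exact: BA].
Qed.

Lemma tadj_lf u : finite_set [set v | tadj u v].
Proof.
apply: (@finite_of_bounded _ (50 * N 2)) => s us H.
apply: (@tball_count 1 u) => // w /H /= uw.
by exists [:: w]; rewrite /= uw.
Qed.

Lemma tadj_conn u v : tvtx u -> tvtx v -> exists2 p, path tadj u p & last u p = v.
Proof.
move=> [m Sm um] [m' Sm' vm'].
wlog le : m m' u v Sm um Sm' vm' / m <= m'.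
  move=> W; have [/W|/ltnW/W] := leqP m m'; first exact.
  move=> /(_ v u)[] // p pp lp; exists (rev (belast v p)).
    by rewrite -lp rev_path (eq_path (e' := tadj)) // => x y; rewrite tadj_sym.
  by rewrite -lp; case: (p) => //= x q; rewrite rev_cons last_rcons.
have um' : u < N m' by apply: leq_trans um _; exact: weight_le.
have [|p [pp lp _]] := @tblock_path m' m' u v Sm' (leqnn _) um'.
  by rewrite !divn_small.
by exists p.
Qed.

Definition tgraph : lfgraph :=
  LFGraph tadj_vtx tadj_sym tadj_irr tadj_lf tadj_conn.

Lemma tgraph_tree : is_tree tgraph.
Proof.
move=> c /andP[]; case: c => // x p cc uc.
have [M /(_ M (leqnn M)) pM] := tpath_tree_path cc.
rewrite -(size_map (twist b d M)); apply: tree_adj_acyclic => //.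
apply/andP; split; first by move: pM; rewrite map_rcons.
by rewrite map_inj_uniq //; exact: twist_inj.
Qed.
End twisted_trees.

(** * Ball sizes as local properties *)

Section local_properties.
Local Open Scope nat_scope.

(** Stated with walks and lists, since these are mapped vertex by vertex under an isomorphism of
    balls. *)
Definition ball_size_le (N : nat -> nat) (G : lfgraph) := forall v k s, vtx G v ->
  uniq s -> (forall w, w \in s -> exists p,
    [/\ path (adj G) v p, last v p = w & size p < 2 ^ k]) -> size s <= N k.

(** The radius 2 (2^k - 1) allows for a walk through the center of a level-[k] block to any of its
    vertices. *)
Definition ball_size_ge (N : nat -> nat) (G : lfgraph) := forall v k, vtx G v ->
  exists s, [/\ uniq s, size s = N k & forall w, w \in s -> exists p,
    [/\ path (adj G) v p, last v p = w & size p <= 2 * (2 ^ k).-1]].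

Section transfer.
Variable k : nat.
Implicit Types G H : mgraph k.

Lemma mball_path G n v p : mball G n v -> path (adj G) v p ->
  forall w, w \in v :: p -> mball G (n + size p) w.
Proof.
elim: p n v => [|x p IH] n v mv /=.
  by move=> _ w; rewrite inE => /eqP ->; rewrite addn0.
move=> /andP[vx pp] w; rewrite inE => /predU1P[->|wp].
  by apply: mball_le mv; rewrite leq_addr.
rewrite addnS -addSn; apply: IH wp => //.
move: mv => /mballP[i [q [pq lq sq]]]; apply/mballP; exists i, (rcons q x).
by rewrite rcons_path pq lq vx last_rcons size_rcons.
Qed.

Lemma path_induced_iso G H A B f v p : induced_iso G H A B f ->
  (forall w, w \in v :: p -> A w) ->
  path (adj H) (f v) (map f p) = path (adj G) v p.
Proof.
move=> [_ ef _]; elim: p v => //= x p IH v Av.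
have Ax : A x by apply: Av; rewrite !inE eqxx orbT.
rewrite ef ?Ax //; last by apply: Av; rewrite inE eqxx.
by rewrite IH // => w wp; apply: Av; rewrite inE wp orbT.
Qed.

Lemma ball_path_iso G H n L f v p : induced_iso G H (mball G (n + L)) (mball H (n + L)) f ->
  mball G n v -> size p <= L -> path (adj G) v p -> path (adj H) (f v) (map f p).
Proof.
move=> If mv pL pp; rewrite (path_induced_iso If) // => w /(mball_path mv pp).
by apply: mball_le; rewrite leq_add2l.
Qed.

Lemma induced_iso_uniq G H A B f s : induced_iso G H A B f ->
  (forall w, w \in s -> A w) -> uniq (map f s) = uniq s.
Proof.
move=> [[_ inj _] _ _] As; apply: map_inj_in_uniq => x y xs ys.
by apply: inj; apply: mem_set; exact: As.
Qed.

(** If [v] is within [n] of a mark, all walks from [v] shorter than 2^j stay in the ball of radius n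
    + 2^j, which is isomorphic to one in a graph with the bound. *)
Lemma ball_size_le_local N G :
  (forall n, exists2 H, ball_iso n G H & ball_size_le N H) -> ball_size_le N G.
Proof.
move=> loc v j s /vtx_mball[n mv] us sP.
have [H [f If] HN] := loc (n + 2 ^ j).
have As w : w \in s -> mball G (n + 2 ^ j) w.
  move=> /sP[p [pp <- sp]]; apply: mball_le (mball_path mv pp (mem_last _ _)).
  by rewrite leq_add2l ltnW.
rewrite -(size_map f); apply: (HN (f v)).
- by have := induced_iso_mball (mball_le (leq_addr _ n)) If mv; exact: mball_vtx.
- by rewrite (induced_iso_uniq If).
- move=> _ /mapP[w /sP[p [pp <- sp]] ->]; exists (map f p).
  by rewrite (ball_path_iso If mv (ltnW sp) pp) last_map size_map.
Qed.

Lemma ball_size_ge_local N G :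
  (forall n, exists2 H, ball_iso n G H & ball_size_ge N H) -> ball_size_ge N G.
Proof.
move=> loc v j /vtx_mball[n mv].
set L := 2 * (2 ^ j).-1.
have [H /ball_iso_sym[f If] HN] := loc (n + L).
have sub (K : mgraph k) : mball K n `<=` mball K (n + L) := mball_le (leq_addr _ n).
have [v' mv' fv] := induced_iso_mball_sur (sub H) (sub G) If mv.
have [s [us ss sP]] := HN v' j (mball_vtx mv').
exists (map f s); rewrite size_map ss (induced_iso_uniq If) //; last first.
  move=> w /sP[p [pp <- sp]]; apply: mball_le (mball_path mv' pp (mem_last _ _)).
  by rewrite leq_add2l.
split=> // _ /mapP[w /sP[p [pp <- sp]] ->]; exists (map f p).
by rewrite -fv (ball_path_iso If mv' sp pp) last_map size_map.
Qed.

Lemma is_tree_local G : (forall n, exists2 H, ball_iso n G H & is_tree H) -> is_tree G.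
Proof.
move=> loc [//|x p] /andP[/= cc uc].
have /vtx_mball[n mx] : vtx G x.
  by case: p cc {uc} => [|y p] /= /andP[/adj_vtx].
have [H [f If] Ht] := loc (n + size (rcons p x)).
have /= := Ht (map f (x :: p)); rewrite size_map; apply.
rewrite /ucycle /= -map_rcons (ball_path_iso If mx _ cc) //=.
rewrite -[_ && _]/(uniq (map f (x :: p))) (induced_iso_uniq If) // => w wp.
by apply: (mball_path mx cc); rewrite -rcons_cons mem_rcons inE wp orbT.
Qed.
End transfer.

Section tgraph_balls.
Variable b : nat -> nat.
Hypothesis b_ge2 : forall n, 1 < b n.
Hypothesis spare_growth : forall n, spare b n.+1 <= (spare b n + 2) ^ 2.
Local Notation N := (base_weight b).
Local Notation T := (tgraph b_ge2 spare_growth).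

Lemma tgraph_ball_size_le S d : ball_size_le (fun k => 50 * N k.+1) (T S d).
Proof. by move=> v k s _ us sP; exact: (tball_count b_ge2 spare_growth us sP). Qed.

Lemma tgraph_ball_size_ge d : ball_size_ge N (T setT d).
Proof.
move=> v k _; exists [seq v %/ N k * N k + i | i <- iota 0 (N k)].
rewrite size_map size_iota map_inj_uniq ?iota_uniq; last by move=> x y /addnI.
split=> // w /mapP[i]; rewrite mem_iota add0n => /= ik ->.
apply: (@tblock_path b b_ge2 setT d (v + k)) => //; first exact: leq_addl.
  by rewrite (leq_trans (ltn_weight b_ge2 v)) // weight_le // leq_addr.
by rewrite div_weightMD.
Qed.
End tgraph_balls.
End local_properties.

(** * From block sizes to growth bounds *)

Section growth_bounds.
Variables (R : realType) (g : R -> R) (N : nat -> nat) (r0 : R).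
Hypothesis g_incr : strictly_increasing g.
Hypothesis r0_gt0 : 0 < r0.
Hypothesis gr0_gt0 : 0 < g r0.
Hypothesis N_ge : forall n, g (r0 * 2 ^+ n) <= 2 * g r0 * (N n)%:R.
Hypothesis N_le : forall n, g r0 * (N n)%:R <= 2 * g (r0 * 2 ^+ n).

Lemma gball_walk (G : lfgraph) v w (r : R) : vtx G v -> 0 <= r ->
  gball G v r w <-> exists p, [/\ path (adj G) v p, last v p = w & (size p)%:R <= r].
Proof.
move=> Vv r_ge0; split.
  move=> [Vw le]; have [[p pp [lp sp]] _] := gdistP Vv Vw.
  by exists p; rewrite sp.
move=> [p [pp lp sp]].
have Vw : vtx G w by rewrite -lp; exact: path_vtx pp.
split=> //; apply: le_trans sp; rewrite ler_nat.
by apply: (gdistP Vv Vw).2; exists p.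
Qed.

Let mono x y : 0 <= x -> x <= y -> g x <= g y.
Proof. by move=> x0; rewrite le_eqVlt => /predU1P[->//|/g_incr xy]; rewrite ltW // xy. Qed.

Lemma pow2_bracket (r : R) : 0 <= r -> exists k, r < 2 ^+ k /\
  (forall j, k = j.+1 -> 2 ^+ j <= r).
Proof.
move=> r_ge0.
have ex : exists k, r < 2 ^+ k.
  exists (Num.truncn r).+1; apply: lt_le_trans (truncnS_gt r) _.
  by rewrite -natrX ler_nat ltnW // ltn_expl.
case: (ex_minnP ex) => k rk kmin; exists k; split=> // j kj.
by rewrite leNgt; apply/negP => /kmin; rewrite kj ltnn.
Qed.

Lemma ball_size_growth_bounds (G : lfgraph) :
  ball_size_le (fun k => 50 * N k.+1)%N G -> ball_size_ge N G ->
  growth_bounds g (r0 / 4) (2 * g r0)^-1 (4 * r0) (100 / g r0) G.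
Proof.
move=> Gle Gge v; have Vv : vtx G (\val v) := set_mem (valP v).
split=> r.
  move=> r_ge0; have [k [rk kr]] := pow2_bracket r_ge0.
  (* Level [k - 2] has 2 (2^(k-2) - 1) <= 2^(k-1) <= r and r / 4 <= 2^(k-2), hence the factor
     [r0 / 4]. For [k <= 1] the subtraction gives level 0, where all walks are empty. *)
  have [s [us ss sP]] := Gge (\val v) (k - 2)%N Vv.
  have sub w : w \in s -> gball G (\val v) r w.
    move=> /sP[p [pp lp sp]]; apply/gball_walk => //; exists p; split=> //.
    case: k rk kr ss sP sp => [|[|k]] rk kr _ _ sp.
    - by rewrite (le_trans _ r_ge0) // lern0; move: sp; case: (size p).
    - by rewrite (le_trans _ r_ge0) // lern0; move: sp; case: (size p).
    - rewrite (le_trans _ (kr _ erefl)) // -natrX ler_nat (leq_trans sp) //.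
      by rewrite subn2 /= expnS leq_mul2l /= leq_pred.
  have le_N : (2 * g r0)^-1 * g (r0 / 4 * r) <= (size s)%:R.
    rewrite mulrC ler_pdivrMr ?mulr_gt0 // ss [leRHS]mulrC.
    apply: le_trans (N_ge _); apply: mono; first by rewrite !mulr_ge0 ?invr_ge0 // ltW.
    rewrite -mulrA ler_pM2l //.
    case: k rk kr {s us ss sP sub} => [|[|k]] rk kr; rewrite ?subn2 /= ?expr0 in rk *.
    - by lra.
    - by rewrite expr1 in rk; lra.
    - by move: rk; rewrite !exprS; lra.
  rewrite /counting; case: asboolP => [fin|_]; last by rewrite leey.
  rewrite lee_fin (le_trans le_N) // ler_nat uniq_leq_size // => w /sub gw.
  by rewrite in_fset_set // mem_set.

move=> r_ge1; have r_ge0 : 0 <= r by rewrite (le_trans _ r_ge1).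
have [k [rk kr]] := pow2_bracket r_ge0.
(* Rounding [r] up to a power of two costs a factor 2, and the level [k.+1] in the count another
   one: hence [4 * r0]. *)
have kr' : 2 ^+ k <= 2 * r.
  case: k rk kr => [|k] rk kr; first by rewrite expr0; lra.
  by rewrite exprS ler_pM2l // kr.
have bnd s : uniq s -> (forall w, w \in s -> gball G (\val v) r w) ->
    (size s <= 50 * N k.+1)%N.
  move=> us sP; apply: (Gle _ _ _ Vv us) => w /sP/(gball_walk _ Vv r_ge0)[p [pp lp sp]].
  by exists p; split=> //; rewrite -(ltr_nat R) natrX (le_lt_trans sp).
have fin := finite_of_bounded bnd.
rewrite /counting asboolT // lee_fin.
have : (#|` fset_set (gball G (\val v) r)| <= 50 * N k.+1)%N.
  apply: bnd; first exact: fset_uniq.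
  by move=> w; rewrite in_fset_set // => /set_mem.
rewrite -(ler_nat R) => /le_trans; apply.
rewrite mulrAC ler_pdivlMr // natrM.
have := N_le k.+1; have : g (r0 * 2 ^+ k.+1) <= g (4 * r0 * r).
  apply: mono; first by rewrite mulr_ge0 ?exprn_ge0 // ltW.
  have := ler_pM2l r0_gt0 (2 ^+ k) (2 * r); rewrite kr' exprS; lra.
nra.
Qed.
End growth_bounds.

(** * The local topology *)

Section local_topology.
Variable k : nat.
Implicit Types G H : mgraph k.

Lemma induced_iso_restrict m G H A B f : mball G m `<=` A -> mball H m `<=` B ->
  induced_iso G H A B f -> ball_iso m G H.
Proof.
move=> mA mB If; exists f; have [[hf jf sf] ef rf] := If; split=> //.
- split.
  + exact: induced_iso_mball If.
  + by move=> u v /set_mem/mA Au /set_mem/mA Av; apply: jf; exact: mem_set.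
  + exact: induced_iso_mball_sur If.
- by move=> u v /mA Au /mA Av; exact: ef.
Qed.

Lemma ball_iso_le m n G H : (m <= n)%N -> ball_iso n G H -> ball_iso m G H.
Proof. by move=> mn [f]; apply: induced_iso_restrict; exact: mball_le. Qed.

Variable R : realType.

Lemma loc_dist_lt m G H : loc_dist R G H < 2 / 2 ^+ m -> ball_iso m G H.
Proof.
case: (loc_distE R G H) => [[+ _] _|[n [_ lt ->]]]; first exact.
rewrite ltr_pM2l // ltf_pV2 ?posrE ?exprn_gt0 // => le; apply: lt.
by rewrite ltnNge; apply/negP => nm; move: le; rewrite ltNge ler_weXn2l ?ler1n.
Qed.

Lemma loc_dist_le m G H : ball_iso m G H -> loc_dist R G H <= 1 / 2 ^+ m.
Proof.
case: (loc_distE R G H) => [[_ ->] _|[n [Hn _ ->]] Hm].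
  by rewrite divr_ge0 ?exprn_ge0.
have mn : (m < n)%N.
  by rewrite ltnNge; apply/negP => /ball_iso_le/(_ Hm).
case: n mn {Hn} => // n; rewrite ltnS => mn.
rewrite exprS invfM mulrA divff // ler_pM2l // lef_pV2 ?posrE ?exprn_gt0 //.
by rewrite ler_weXn2l ?ler1n.
Qed.

Lemma open_ballP (U : set (mgspace R k)) : open U <->
  forall x, U x -> exists n, forall y, ball_iso n (repr x) (repr y) -> U y.
Proof.
rewrite openE; split=> HU x Ux.
  have /nbhs_ballP[e /= e0 eU] := HU _ Ux.
  have [n en] : exists n, 1 / 2 ^+ n < e.
    exists (Num.truncn e^-1).+1; rewrite div1r invf_plt ?posrE ?exprn_gt0 //.
    apply: lt_trans (truncnS_gt _) _.
    by rewrite -natrX ltr_nat ltn_expl.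
  exists n => y /loc_dist_le le; apply: eU.
  by rewrite ballEmdist; apply: le_lt_trans en.
apply/nbhs_ballP; have [n nU] := HU _ Ux.
exists (2 / 2 ^+ n) => /=; first by rewrite divr_gt0 ?exprn_gt0.
by move=> y xy; apply: nU; apply: loc_dist_lt; move: xy; rewrite ballEmdist.
Qed.
End local_topology.

Section limits.
Context d (X : measurableType d) (R : realType) (k : nat).

(** For open [U], [f x] lies in [U] iff, for some [n], all late approximants lie in the set [V n] of
    points whose [n]-ball forces membership in [U]. This is a countable combination of preimages
    under the [f_ m]. *)
Lemma measurable_local_limit (f_ : nat -> X -> mgspace R k) (f : X -> mgborel R k) :
  (forall m A, measurable (f_ m @^-1` A)) ->
  (forall n x, exists m0, forall m, (m0 <= m)%N ->
    ball_iso n (repr (f_ m x)) (repr (f x : mgspace R k))) ->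
  measurable_fun setT f.
Proof.
move=> mf_ cvg; apply: (@measurability _ _ X (mgborel R k) setT f (@open (mgspace R k))) => //.
move=> _ [U /open_ballP openU <-]; rewrite setTI.
pose V n : set (mgspace R k) :=
  [set x | forall y, ball_iso n (repr x) (repr y) -> U y].
rewrite (_ : f @^-1` U = \bigcup_n \bigcup_m0 \bigcap_(m in [set m | (m0 <= m)%N])
    (f_ m @^-1` V n)).
  apply: bigcup_measurable => n _; apply: bigcup_measurable => m0 _.
  by apply: bigcap_measurableType => m _; exact: mf_.
apply/seteqP; split=> x.
  move=> /openU[n nU]; exists n => //; have [m0 m0P] := cvg n x.
  exists m0 => // m /= mm0 y iy; apply: nU.
  by apply: ball_iso_trans iy; apply: ball_iso_sym; exact: m0P.
move=> [n _ [m0 _ H]]; have [m1 m1P] := cvg n x.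
apply: (H (maxn m0 m1)) => /=; first exact: leq_maxl.
by apply: m1P; exact: leq_maxr.
Qed.
End limits.

(** * Marked trees and their truncations *)

Section marked_trees.
Variable b : nat -> nat.
Hypothesis b_ge2 : forall n, (1 < b n)%N.
Hypothesis spare_growth : forall n, (spare b n.+1 <= (spare b n + 2) ^ 2)%N.
Local Notation N := (base_weight b).
Local Notation T := (tgraph b_ge2 spare_growth).

Section marks.
Variables (k : nat) (S : set nat) (d : nat -> nat) (mk : 'I_k.+1 -> nat).
Hypothesis mkP : forall i, tvtx b S (mk i).

Definition mtgraph : mgraph k :=
  @MGraph k (T S d) (fun i => exist _ (mk i) (mem_set (mkP i))).
End marks.

Lemma tvtxT x : tvtx b setT x.
Proof. by exists x => //; exact: ltn_weight. Qed.

Variable k : nat.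
Implicit Types (d : nat -> nat) (mk : 'I_k.+1 -> nat).

Definition mtree d mk : mgraph k := mtgraph d (fun i => tvtxT (mk i)).

(* The truncation level j + \sum_i mk i is large enough for the marks to be
   vertices. *)
Lemma tvtx_trunc j mk i : tvtx b [set (j + \sum_i mk i)%N] (mk i).
Proof.
exists (j + \sum_i mk i)%N => //.
rewrite (leq_trans (ltn_weight b_ge2 _)) // weight_le // (bigD1 i) //=.
by rewrite addnCA leq_addr.
Qed.

Definition mtree_trunc j d mk : mgraph k := mtgraph d (tvtx_trunc j mk).

(** Since [w < N w], a level above all labels in the [n]-ball gives a truncation containing that
    ball; conversely, walks in the truncation are walks in the tree. *)
Lemma mtree_trunc_ball n d mk : exists j0, forall j, (j0 <= j)%N ->
  ball_iso n (mtree_trunc j d mk) (mtree d mk).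
Proof.
have /finite_seqP[s sE] := finite_mball (mtree d mk) n.
exists (\max_(x <- s) x) => j sj; set M := (j + \sum_i mk i)%N.
have inM w : mball (mtree d mk) n w -> (w < N M)%N.
  rewrite sE /= => ws; apply: leq_trans (ltn_weight b_ge2 _) (weight_le b_ge2 _).
  rewrite (leq_trans _ (leq_addr _ _)) // (leq_trans _ sj) //.
  exact: (@leq_bigmax_seq _ _ xpredT id).
have adjE u v : (u < N M)%N -> (v < N M)%N ->
    adj (mtree_trunc j d mk) u v = adj (mtree d mk) u v.
  by move=> uM vM; rewrite /= (@tadj_at b b_ge2 _ d M) // (@tadj_at b b_ge2 setT d M).
have mE : mball (mtree_trunc j d mk) n = mball (mtree d mk) n.
  apply/seteqP; split=> w /mballP[i [p [pp <- sp]]]; apply/mballP; exists i, p; split=> //.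
    apply: sub_path pp => u v /asboolP[m [Sm um vm a]].
    by apply/asboolP; exists m.
  apply: (@sub_in_path _ [pred x | (x < N M)%N] (adj (mtree d mk)) _ _ _ _ _ pp).
    by move=> u v uM vM uv; exact: (etrans (adjE u v uM vM) uv).
  apply/allP => x xp; apply: inM.
  have mroot : mball (mtree d mk) 0 (rootn (mtree d mk) i) by exact: mball_root.
  by apply: mball_le (mball_path mroot pp xp).
exists id; rewrite mE; split=> //.
  by have [] := induced_iso_id (mtree d mk) (mball (mtree d mk) n).
by move=> u v /inM uM /inM vM; rewrite adjE.
Qed.

Lemma mtree_trunc_eq j d d' mk :
  (forall l, (l < j + \sum_i mk i)%N -> d l = d' l) ->
  mg_iso (mtree_trunc j d mk) (mtree_trunc j d' mk).
Proof.
move=> e; exists id; split=> //.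
  by have [] := induced_iso_id (mtree_trunc j d mk) (vtx (mtree_trunc j d mk)).
move=> u v _ _; have eT m x : m = (j + \sum_i mk i)%N -> twist b d m x = twist b d' m x.
  by move=> mE; apply: eq_twist => l; rewrite mE; exact: e.
by apply/asboolP/asboolP => -[m [Sm um vm]] a; exists m; move: a; rewrite !eT.
Qed.

(** The first [m] digits only say where the root sits in its copy of T_m. Setting them to 0 and
    relabelling by the twist yields the same tree with the marks moved. *)
Lemma mtree_twist d d' m mk : (forall l, (l < m)%N -> d' l = 0%N) ->
  (forall l, (m <= l)%N -> d' l = d l) ->
  mg_iso (mtree d mk) (mtree d' (twist b d m \o mk)).
Proof.
move=> lo hi; exists (twist b d m); split=> //.
  split=> [x _|x y _ _|x _]; first exact: tvtxT.
    exact: twist_inj.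
  by have [y] := twist_surj b_ge2 d m x; exists y => //; exact: tvtxT.
move=> u v _ _ /=; pose M := maxn m (maxn u v).
have uM : (u < N M)%N.
  by apply: leq_trans (ltn_weight b_ge2 _) (weight_le b_ge2 _); lia.
have vM : (v < N M)%N.
  by apply: leq_trans (ltn_weight b_ge2 _) (weight_le b_ge2 _); lia.
have mM : (m <= M)%N by exact: leq_maxl.
rewrite !(@tadj_at b b_ge2 setT _ M) ?ltn_twist //.
by rewrite !(twist_twist b_ge2 _ mM lo hi).
Qed.
End marked_trees.

(** * Random digits *)

Section lebesgue_translation.
Variable R : realType.
Local Notation leb := (@lebesgue_measure R).
Local Open Scope ereal_scope.

Lemma measurable_translation (a : R) :
  measurable_fun setT (fun x : measurableTypeR R => (x + a)%R : measurableTypeR R).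
Proof. exact: measurable_funD. Qed.

Lemma integral_translation (a e : R) (F : measurableTypeR R -> \bar R) :
  measurable_fun setT F -> (forall x, 0 <= F x) ->
  \int[leb]_(x in `[a, (a + e)%R[) F x = \int[leb]_(x in `[0%R, e[) F (x + a)%R.
Proof.
move=> mF F0; pose phi (x : measurableTypeR R) : measurableTypeR R := (x + a)%R.
have mphi : measurable_fun setT phi := measurable_translation a.
transitivity (\int[pushforward leb phi]_(x in `[a, (a + e)%R[) F x).
  apply: eq_measure_integral => A mA _.
  apply: lebesgue_measure_unique => // _ [[u v] /= uv <-].
  rewrite /pushforward (_ : phi @^-1` _ = `](u - a)%R, (v - a)%R]%classic); last first.
    by apply/seteqP; split=> x /=; rewrite !in_itv /= /phi; lra.
  rewrite !lebesgue_measure_itv /= !lte_fin ltrD2r -!EFinB.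
  by case: ifP => // _; congr EFin; lra.
rewrite ge0_integral_pushforward //.
- congr integral; apply/seteqP; split=> x /=; rewrite !in_itv /= /phi; lra.
- exact: measurable_funTS.
Qed.

Lemma integral_split_itv (c : nat) (e : R) (F : measurableTypeR R -> \bar R) :
  (0 < e)%R -> measurable_fun setT F -> (forall x, 0 <= F x) ->
  \int[leb]_(x in `[0%R, (c%:R * e)%R[) F x =
  \sum_(j < c) \int[leb]_(x in `[0%R, e[) F (x + j%:R * e)%R.
Proof.
move=> e0 mF F0; elim: c => [|c IH].
  rewrite mul0r big_ord0 set_itvco0 integral_set0 //.
rewrite big_ord_recr /= -IH -integral_translation //.
rewrite (_ : `[0%R, (c.+1%:R * e)%R[ =
    `[0%R, (c%:R * e)%R[ `|` `[(c%:R * e)%R, (c%:R * e + e)%R[)%classic; last first.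
  have c0 : (0 <= c%:R * e)%R by rewrite mulr_ge0 // ltW.
  rewrite -natr1 mulrDl mul1r.
  apply/seteqP; split=> x /=; rewrite !in_itv /=; last first.
    by move=> []; lra.
  by case: (ltP x (c%:R * e)%R) => h H; [left|right]; lra.
apply: ge0_integral_setU => //.
- exact: measurable_funTS.
- by apply/disj_setPS => x /= []; rewrite !in_itv /=; lra.
Qed.

Lemma integral_uniform_split (c : nat) (F : measurableTypeR R -> \bar R) :
  (0 < c)%N -> measurable_fun setT F -> (forall x, 0 <= F x) ->
  \int[uniform_prob (@ltr01 R)]_x F x =
  \sum_(j < c) \int[leb]_(x in `[0%R, (c%:R^-1)%R[) F (x + j%:R / c%:R)%R.
Proof.
move=> c0 mF F0; rewrite integral_uniform // subr0 invr1 mul1e.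
rewrite -integral_itv_bndo_bndc; last exact: measurable_funTS.
rewrite -integral_split_itv ?invr_gt0 ?ltr0n //.
by rewrite divff // pnatr_eq0 -lt0n.
Qed.
End lebesgue_translation.

Section random_digits.
Variable R : realType.

Lemma truncn_mulnK (y : R) c : (0 < c)%N ->
  (Num.truncn (y * c%:R) %/ c)%N = Num.truncn y.
Proof.
move=> c0; have c0' : 0 < c%:R :> R by rewrite ltr0n.
have [y0|y0] := leP 0 y; last first.
  have -> : Num.truncn (y * c%:R) = 0%N.
    by apply/truncn0Pn; rewrite -ltNge (lt_trans _ ltr01) // pmulr_llt0.
  by rewrite div0n; apply/esym/truncn0Pn; rewrite -ltNge (lt_trans y0).
apply/esym/truncn_def; set t := Num.truncn _.
have /andP[t1 t2] : t%:R <= y * c%:R < t.+1%:R by rewrite truncn_itv // mulr_ge0.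
rewrite -(ler_pM2r c0') -(ltr_pM2r c0') -!natrM (le_trans _ t1) ?ler_nat ?leq_divM //.
by rewrite (lt_le_trans t2) // ler_nat -ltn_divLR // ltnSn.
Qed.

Lemma truncn_addn (y : R) n : 0 <= y -> Num.truncn (y + n%:R) = (Num.truncn y + n)%N.
Proof.
move=> y0; apply: truncn_def; have /andP[y1 y2] := truncn_itv y0.
by rewrite natrD lerD2r y1 -addSn natrD ltrD2r.
Qed.

Lemma truncn_preimage (c : R) J : 0 < c ->
  measurable [set x : measurableTypeR R | Num.truncn (x * c) = J].
Proof.
move=> c0.
have mc : measurable_fun setT (fun x : measurableTypeR R => x * c).
  exact: measurable_funM.
have lt n : measurable [set x : measurableTypeR R | x * c < n%:R].
  rewrite (_ : [set x | _] = setT `&` (fun x => x * c) @^-1` `]-oo, n%:R[).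
    by apply: mc => //; exact: measurable_itv.
  by rewrite setTI; apply/seteqP; split=> x /=; rewrite in_itv.
have E n x : (Num.truncn (x * c) < n.+1)%N = (x * c < n.+1%:R).
  have [x0|x0] := leP 0 (x * c); first by rewrite truncn_lt_nat.
  have -> : Num.truncn (x * c) = 0%N.
    by apply/truncn0Pn; rewrite -ltNge (lt_trans x0).
  by rewrite ltnS leq0n (lt_trans x0).
case: J => [|J].
  (* [Num.truncn] is 0 on negative reals, so this preimage is a half-line. *)
  rewrite (_ : [set _ | _] = [set x | x * c < 1%:R]); first exact: lt.
  apply/seteqP; split=> x /=; rewrite -E ltnS leqn0; first by move=> ->.
  by move/eqP.
rewrite (_ : [set _ | _] = [set x | x * c < J.+2%:R] `\` [set x | x * c < J.+1%:R]).
  by apply: measurableD; exact: lt.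
apply/seteqP; split=> x /=; rewrite -!E ?ltnS.
  by move=> ->; rewrite leqnn ltnn.
by move=> [le /negP nle]; apply/eqP; rewrite eqn_leq le ltnNge.
Qed.

Variable b : nat -> nat.
Hypothesis b_ge2 : forall n, (1 < b n)%N.
Hypothesis spare_growth : forall n, (spare b n.+1 <= (spare b n + 2) ^ 2)%N.
Local Notation N := (base_weight b).

(** The leading digit of [x] serves as digit 0, the least significant one of a label; so changing
    the first [m] digits translates [x] by a multiple of 1 / N_m. *)
Definition real_digit (x : R) l := (Num.truncn (x * (N l.+1)%:R) %% b l)%N.

Lemma truncn_weight (x : R) m l : (m <= l)%N ->
  Num.truncn (x * (N m)%:R) = (Num.truncn (x * (N l)%:R) %/ (N l %/ N m))%N.
Proof.
move=> /(weight_dvd b)/dvdnP[c e]; have N0 n := weight_gt0 b_ge2 n.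
have c0 : (0 < c)%N by have := N0 l; rewrite e muln_gt0 => /andP[].
by rewrite e mulnK // mulnC natrM mulrA truncn_mulnK.
Qed.

Lemma eq_real_digit (x x' : R) m l :
  Num.truncn (x * (N m)%:R) = Num.truncn (x' * (N m)%:R) -> (l < m)%N ->
  real_digit x l = real_digit x' l.
Proof. by move=> e lm; rewrite /real_digit !(truncn_weight _ lm) e. Qed.

Lemma real_digits_inj x x' m : 0 <= x < 1 -> 0 <= x' < 1 ->
  (forall l, (l < m)%N -> real_digit x l = real_digit x' l) ->
  Num.truncn (x * (N m)%:R) = Num.truncn (x' * (N m)%:R).
Proof.
move=> x01 x'01; elim: m => [|m IH] H.
  have E (y : R) : 0 <= y < 1 -> Num.truncn (y * (N 0)%:R) = 0%N.
    move=> /andP[_ y1]; apply/truncn0Pn; rewrite weight0 mulr1. by rewrite -ltNge.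
  by rewrite !E.
have bE : (N m.+1 %/ N m)%N = b m by rewrite weightS mulKn // weight_gt0.
have := IH (fun l lm => H l (ltnW lm)); rewrite !(truncn_weight _ (leqnSn m)) bE.
have := H m (ltnSn m); rewrite /real_digit.
move: (Num.truncn _) (Num.truncn _) => s t e1 e2.
by rewrite (divn_eq t (b m)) (divn_eq s (b m)) e1 e2.
Qed.

(** Adding j / N_m changes y N_(l+1) by a multiple of b_l when m <= l. *)
Lemma real_digit_shift m (j : nat) y : 0 <= y < (N m)%:R^-1 ->
  (forall l, (l < m)%N -> real_digit y l = 0%N) /\
  (forall l, (m <= l)%N -> real_digit (y + j%:R / (N m)%:R) l = real_digit y l).
Proof.
move=> /andP[y0 yN]; have Nm0 : 0 < (N m)%:R :> R by rewrite ltr0n weight_gt0.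
have ty : Num.truncn (y * (N m)%:R) = 0%N.
  by apply/truncn0Pn; rewrite -ltNge -ltr_pdivlMr // div1r.
split=> l lm; first by rewrite /real_digit (truncn_weight _ lm) ty div0n mod0n.
have /dvdnP[c ec] := weight_dvd b lm.
rewrite /real_digit.
have -> : (y + j%:R / (N m)%:R) * (N l.+1)%:R =
    y * (N l.+1)%:R + (j * c * b l)%:R.
  rewrite weightS ec mulrDl; congr (_ + _).
  by rewrite !natrM [c%:R * _]mulrC !mulrA divfK // gt_eqF.
by rewrite truncn_addn ?mulr_ge0 // addnC modnMDl.
Qed.
End random_digits.

(** * The random tree *)

Lemma ball_iso_pi (R : realType) k n (G H : mgraph k) : ball_iso n G H ->
  ball_iso n (repr (\pi_(mgspace R k) G)) (repr (\pi_(mgspace R k) H)).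
Proof.
move=> GH; apply: ball_iso_trans (mg_iso_ball n (repr_pi R G)) _.
by apply: ball_iso_trans GH _; apply/ball_iso_sym/mg_iso_ball/repr_pi.
Qed.

Section random_tree.
Variables (R : realType) (b : nat -> nat).
Hypothesis b_ge2 : forall n, (1 < b n)%N.
Hypothesis spare_growth : forall n, (spare b n.+1 <= (spare b n + 2) ^ 2)%N.
Local Notation N := (base_weight b).
Local Notation mtree := (mtree b_ge2 spare_growth).
Local Notation mtree_trunc := (mtree_trunc b_ge2 spare_growth).

Definition random_mtree k (mk : 'I_k.+1 -> nat) (x : measurableTypeR R) : mgborel R k :=
  \pi_(mgspace R k) (mtree (real_digit b x) mk).

Lemma measurable_random_mtree k (mk : 'I_k.+1 -> nat) :
  measurable_fun setT (random_mtree mk).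
Proof.
pose f_ j (x : measurableTypeR R) :=
  \pi_(mgspace R k) (mtree_trunc j (real_digit b x) mk).
apply: (@measurable_local_limit _ _ _ _ f_) => [j A|n x]; last first.
  have [j0 j0P] := mtree_trunc_ball b_ge2 spare_growth n (real_digit b x) mk.
  by exists j0 => j /j0P ij; exact: ball_iso_pi.
set M := (j + \sum_i mk i)%N.
have N0 : 0 < (N M)%:R :> R by rewrite ltr0n weight_gt0.
pose J (x : R) := Num.truncn (x * (N M)%:R).
(* A truncation sees finitely many digits, so [f_ j] is constant on each of the countably many level
   sets of [J]. *)
have fJ x x' : J x = J x' -> f_ j x = f_ j x'.
  move=> e; apply/pi_mg_iso/mtree_trunc_eq => l lM.
  exact: eq_real_digit e lM.
rewrite (_ : f_ j @^-1` A =
    \bigcup_(i in [set i | exists2 x, J x = i & A (f_ j x)]) [set x | J x = i]).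
  by apply: bigcup_measurable => i _; exact: truncn_preimage.
apply/seteqP; split=> x /=; first by move=> Ax; exists (J x) => //; exists x.
by move=> [i [x' e Ax'] /= xi]; rewrite /preimage /= (fJ x x') // xi e.
Qed.

Definition random_tree : measurableTypeR R -> mgborel R 0 :=
  random_mtree (fun _ : 'I_1 => 0%N).

HB.instance Definition _ := isMeasurableFun.Build _ _ _ _ random_tree
  (measurable_random_mtree (fun _ : 'I_1 => 0%N)).

Definition random_tree_law : random_rooted_graph R :=
  distribution (uniform_prob (@ltr01 R)) random_tree.

(** The classes with some ball that occurs in no tree of the family form an open set, whose preimage
    under [random_tree] is empty; outside this null set [P] holds. *)
Lemma random_tree_law_local (P : mgraph 0 -> Prop) :
  (forall G : mgraph 0,
    (forall n, exists d, ball_iso n G (mtree d (fun=> 0%N))) -> P G) ->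
  {ae random_tree_law, forall t : mgborel R 0, P (rep t)}.
Proof.
move=> PH; pose bad : set (mgspace R 0) :=
  [set t | exists n, forall d, ~ ball_iso n (repr t) (mtree d (fun=> 0%N))].
exists (bad : set (mgborel R 0)); split.
- apply: sub_sigma_algebra; apply/open_ballP => t [n tn].
  exists n => t' tt'; exists n => d dt'; apply: (tn d).
  exact: ball_iso_trans tt' dt'.
- rewrite /random_tree_law /distribution /pushforward /=.
  rewrite (_ : _ @^-1` _ = set0) ?measure0 //.
  apply/seteqP; split=> // x [n /(_ (real_digit b x))]; apply.
  exact: (mg_iso_ball n (repr_pi R _)).
- move=> t /= nP; apply: contrapT => nbad; apply: nP; apply: PH => n.
  apply: contrapT => no; apply: nbad; exists n => d td; apply: no.
  by exists d.
Qed.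
End random_tree.

(** * Measurability of sums over the vertices *)

Section second_mark.
Variables (R : realType) (c : bool).
Implicit Types G H : mgraph 0.

Definition vertex_at G (w : nat) : vertex G := insubd (mark G ord0) w.

Lemma val_vertex_at G w : vtx G w -> \val (vertex_at G w) = w.
Proof. by move=> Gw; rewrite /vertex_at insubdK //; exact: mem_set. Qed.

(* [c] tells whether the new mark comes first. *)
Definition add_mark G (w : nat) : mgraph 1 :=
  @MGraph 1 G (fun i => if (i == ord0) (+) c then mark G ord0 else vertex_at G w).

Definition mark_pair G (x : vertex G) : mgborel R 1 :=
  if c then bimark R x (mark G ord0) else bimark R (mark G ord0) x.

Lemma mark_pairE G w : mark_pair (vertex_at G w) = \pi_(mgspace R 1) (add_mark G w).
Proof.
rewrite /mark_pair /add_mark /bimark; case: c => //=; congr \pi; congr MGraph;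
  by apply/funext => i; case: (i == ord0).
Qed.

Lemma rootn_add_mark G w i : vtx G w ->
  rootn (add_mark G w) i = if (i == ord0) (+) c then rootn G ord0 else w.
Proof. by move=> Gw; rewrite /rootn /=; case: ifP => // _; rewrite val_vertex_at. Qed.

Lemma add_mark_iso G H A B h w : vtx G w -> vtx H (h w) ->
  induced_iso G H A B h -> induced_iso (add_mark G w) (add_mark H (h w)) A B h.
Proof.
move=> Gw Hw [bh eh rh]; split=> // i.
by rewrite !rootn_add_mark //; case: ifP.
Qed.

Lemma mball_add_mark G w n m : mball G n w -> mball (add_mark G w) m `<=` mball G (n + m).
Proof.
move=> nw v /mballP[i [p [pp <- pm]]].
have r0 : mball G n (rootn (add_mark G w) i).
  rewrite rootn_add_mark; first by case: ifP => // _; exact: mball_root.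
  exact: mball_vtx nw.
apply: mball_le (@mball_path 0 G n _ p r0 pp _ (mem_last _ _)).
by rewrite leq_add2l.
Qed.

Lemma esum_mark_pairE G (f : mgborel R 1 -> \bar R) :
  (\esum_(x in [set: vertex G]) f (mark_pair x) =
   \esum_(w in vtx G) f (\pi_(mgspace R 1) (add_mark G w)))%E.
Proof.
have bij : set_bij [set: vertex G] (vtx G) (fun x => \val x).
  split=> [x _|x y _ _|w Gw]; first exact: set_mem (valP x).
    exact: val_inj.
  by exists (vertex_at G w) => //; exact: val_vertex_at.
rewrite (reindex_esum _ _ _ _ bij); apply: eq_esum => x _.
by rewrite -mark_pairE /vertex_at valKd.
Qed.

Lemma esum_mark_pair_iso G H (f : mgborel R 1 -> \bar R) : mg_iso G H ->
  (\esum_(x in [set: vertex G]) f (mark_pair x) =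
   \esum_(x in [set: vertex H]) f (mark_pair x))%E.
Proof.
move=> [h If]; have [[hh _ _] _ _] := If; have [bh _ _] := If.
rewrite !esum_mark_pairE (reindex_esum _ _ _ _ bh); apply: eq_esum => w Gw.
congr f; apply/pi_mg_iso; exists h; apply: add_mark_iso => //; exact: hh.
Qed.

End second_mark.

Section counting_kernel.
Variables (R : realType) (c : bool).
Local Notation pair t w := (\pi_(mgspace R 1) (add_mark c (rep t) w) : mgborel R 1).

Definition marked_in n (t : mgborel R 0) (A : set (mgborel R 1)) : set nat :=
  [set w | mball (rep t) n w /\ A (pair t w)].

Lemma finite_marked_in n t A : finite_set (marked_in n t A).
Proof. by apply: sub_finite_set (finite_mball (rep t) n) => w []. Qed.

Lemma counting_le (A B : set nat) h : finite_set A -> finite_set B ->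
  (forall x, A x -> B (h x)) -> set_inj A h ->
  (counting A <= counting B :> \bar R)%E.
Proof.
move=> fA fB AB injh; rewrite /counting !asboolT // lee_fin ler_nat.
rewrite -(size_map h); apply: uniq_leq_size.
  rewrite map_inj_in_uniq ?fset_uniq // => x y.
  by rewrite !in_fset_set //; exact: injh.
move=> _ /mapP[x + ->]; rewrite !in_fset_set // => /set_mem/AB Bx.
exact: mem_set.
Qed.

(* [t |-> counting (marked_in n t U)] is lower semicontinuous. *)
Lemma marked_in_open n t (U : set (mgspace R 1)) : open U ->
  exists m, forall t' : mgborel R 0, ball_iso m (rep t) (rep t') ->
    (counting (marked_in n t U) <= counting (marked_in n t' U) :> \bar R)%E.
Proof.
move=> /open_ballP openU.
have /choice[mu muP] : forall w, exists m, U (pair t w) ->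
    forall y, ball_iso m (repr (pair t w : mgspace R 1)) (repr y) -> U y.
  move=> w; have [/openU[m mU]|nU] := pselect (U (pair t w)); last by exists 0%N.
  by exists m.
have /finite_seqP[s sE] := finite_marked_in n t U.
pose m := (\max_(w <- s) mu w)%N.
(* Both marks are within [n] of the root, so the [m]-ball around them lies in the (n + m)-ball of
   the root. *)
exists (n + m)%N => t' [h If].
apply: (@counting_le _ _ h); [exact: finite_marked_in|exact: finite_marked_in| |].
  move=> w Uw; have [nw Utw] := Uw.
  have sub (k : mgborel R 0) : mball (rep k) n `<=` mball (rep k) (n + m) := mball_le (leq_addr _ _).
  have nhw : mball (rep t') n (h w) by exact: (induced_iso_mball (sub t) If nw).
  split=> //; apply: muP Utw _ _; apply: ball_iso_pi.
  apply: (@ball_iso_le _ _ m).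
    by apply: leq_bigmax_seq => //; move: Uw; rewrite sE.
  apply: (@induced_iso_restrict _ _ _ _ (mball (rep t) (n + m)) (mball (rep t') (n + m)) h).
  - exact: mball_add_mark.
  - exact: mball_add_mark.
  - by apply: add_mark_iso => //; exact: mball_vtx nhw || exact: mball_vtx nw.
have [[_ inj _] _ _] := If.
move=> x y /set_mem[nx _] /set_mem[ny _]; apply: inj; apply: mem_set.
  exact: mball_le (leq_addr _ _) _ nx.
exact: mball_le (leq_addr _ _) _ ny.
Qed.

Definition mark_atom n (t : mgborel R 0) w : {measure set (mgborel R 1) -> \bar R} :=
  if `[< mball (rep t) n w >] then \d_(pair t w) : {measure set _ -> \bar R} else mzero.

(** A series of Dirac masses is a measure by construction; [mark_kernelE] identifies it with a
    count. *)
Definition mark_kernel n t := mseries (mark_atom n t) 0.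

HB.instance Definition _ n t := Measure.on (mark_kernel n t).

Lemma mark_kernelE n t A : mark_kernel n t A = counting (marked_in n t A).
Proof.
rewrite /mark_kernel /mseries counting_dirac; apply: eq_eseriesr => w _.
rewrite /mark_atom.
case: asboolP => [nw|nw] /=; rewrite ?diracE.
  suff -> : (w \in marked_in n t A) = (pair t w \in A) by [].
  by apply/idP/idP => /set_mem; [case=> _ ?|move=> ?]; exact: mem_set.
by rewrite memNset // => -[].
Qed.

(** On open sets, lower semicontinuity makes the superlevel sets open. The rest is a Dynkin-class
    argument, with open sets as the pi-system and finiteness of balls for the differences. *)
Lemma measurable_mark_kernel n A : measurable A ->
  measurable_fun setT (fun t => mark_kernel n t A).
Proof.
move=> mA; pose H := [set B : set (mgborel R 1) |
  measurable B /\ measurable_fun setT (fun t => mark_kernel n t B)].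
have Hopen : @open (mgspace R 1) `<=` H.
  move=> U oU; split; first exact: sub_sigma_algebra.
  apply: (measurability _ (ErealGenOInfty.measurableE R)) => // _ [_ [r ->] <-].
  rewrite setTI; apply: sub_sigma_algebra; apply/open_ballP => t /= rt.
  have [m mP] := marked_in_open n t oU; exists m => t' /mP le.
  move: rt; rewrite /= !in_itv /= !andbT => /lt_le_trans; apply.
  by rewrite !mark_kernelE.
suff sub : <<s @open (mgspace R 1) >> `<=` H by have [] := sub _ mA.
apply: lambda_system_subset => //; first by move=> U V; exact: openI.
have fin t B : (mark_kernel n t B < +oo)%E.
  rewrite mark_kernelE /counting asboolT ?ltry //; exact: finite_marked_in.
split=> //.
- by apply: Hopen; exact: openT.
- move=> B C CB [mB kB] [mC kC]; split; first exact: measurableD.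
  rewrite (_ : (fun t => _) = (fun t => mark_kernel n t B - mark_kernel n t C)%E).
    exact: emeasurable_funB.
  apply/funext => t; rewrite -[in RHS](setIidr CB).
  exact: (@measureD _ _ _ (mark_kernel n t) B C mB mC (fin t B)).
- move=> F ndF HF; have mF i : measurable (F i : set (mgborel R 1)) by case: (HF i).
  split; first exact: bigcupT_measurable.
  apply: (@emeasurable_fun_cvg _ _ _ _ (fun i t => mark_kernel n t (F i))).
    by move=> i; case: (HF i).
  by move=> t _; apply: nondecreasing_cvg_mu => //; exact: bigcupT_measurable.
Qed.

Lemma integral_mark_kernel n t (f : mgborel R 1 -> \bar R) :
  measurable_fun setT f -> (forall y, 0 <= f y)%E ->
  (\int[mark_kernel n t]_y f y =
   \int[counting]_(w in setT) (if `[< mball (rep t) n w >] then f (pair t w) else 0))%E.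
Proof.
move=> mf f0; rewrite ge0_integral_count; last by move=> w; case: ifP.
rewrite ge0_integral_measure_series //; apply: eq_eseriesr => w _; rewrite /mark_atom.
case: ifP => _; last by rewrite integral_measure_zero.
by rewrite integral_dirac // diracT mul1e.
Qed.

(** The sum over all vertices is the monotone limit of the sums over balls, which are integrals
    against the kernels. *)
Lemma measurable_esum_mark (f : mgborel R 1 -> \bar R) :
  measurable_fun setT f -> (forall y, 0 <= f y)%E ->
  measurable_fun setT (fun t : mgborel R 0 =>
    (\esum_(x in [set: vertex (rep t)]) f (mark_pair R c x))%E).
Proof.
move=> mf f0.
apply: (@emeasurable_fun_cvg _ _ _ _ (fun n t => \int[mark_kernel n t]_y f y)%E).
  move=> n; apply: (@measurable_fun_integral_kernel _ _ _ _ _ (mark_kernel n)) => //.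
  by move=> U mU; exact: measurable_mark_kernel.
move=> t _; rewrite esum_mark_pairE.
under eq_fun do rewrite integral_mark_kernel //.
rewrite esum_mkcond -nneseries_esumT; last by move=> w; case: ifP.
rewrite -ge0_integral_count; last by move=> w; case: ifP.
pose a_ n w := (if `[< mball (rep t) n w >] then f (pair t w) else 0)%E.
pose a w := (if w \in vtx (rep t) then f (pair t w) else 0)%E.
suff aE w : a w = limn (a_ ^~ w).
  rewrite (_ : (\int[counting]_w _)%E = (\int[counting]_w (limn (a_ ^~ w)))%E); last first.
    by apply: eq_integral => w _; exact: aE.
  apply: cvg_monotone_convergence => //.
  - by move=> n w' _; rewrite /a_; case: ifP.
  - move=> w' _ m n mn; rewrite /a_; case: asboolP => [mw|_]; last by case: ifP.
    by rewrite asboolT //; exact: mball_le mn _ mw.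
apply/esym/cvg_lim => //; rewrite /a.
case: ifPn => [/set_mem/vtx_mball[m mw]|/negP nw].
  apply: cvg_near_cst; exists m => // n mn.
  by rewrite /a_ asboolT //; exact: mball_le mn _ mw.
apply: cvg_near_cst; apply: nearW => n; rewrite /a_ asboolF // => /mball_vtx vw.
by apply: nw; exact: mem_set.
Qed.
End counting_kernel.

(** * Mass transport *)

(** Partial sums increase, so agreement along unbounded indices suffices. *)
Lemma le_nneseries_subseq (R : realType) (u v : nat -> \bar R) (N : nat -> nat) :
  (forall n, 0 <= u n)%E -> (forall n, 0 <= v n)%E -> (forall n, (n <= N n)%N) ->
  (forall n, \sum_(0 <= i < N n) u i = \sum_(0 <= i < N n) v i)%E ->
  (\sum_(i <oo) u i <= \sum_(i <oo) v i)%E.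
Proof.
move=> u0 v0 Nn uv; apply: lime_le; first by apply: is_cvg_nneseries => n _ _.
apply: nearW => n; apply: (@le_trans _ _ (\sum_(0 <= i < N n) u i)%E).
  by apply: lee_sum_nneg_natr => // i _ _.
by rewrite uv; apply: nneseries_lim_ge => i _.
Qed.

Section mass_transport.
Variables (R : realType) (b : nat -> nat).
Hypothesis b_ge2 : forall n, (1 < b n)%N.
Hypothesis spare_growth : forall n, (spare b n.+1 <= (spare b n + 2) ^ 2)%N.
Local Notation N := (base_weight b).
Local Notation mtree := (mtree b_ge2 spare_growth).
Local Notation leb := (@lebesgue_measure R).
Local Notation unif := (uniform_prob (@ltr01 R)).

Definition two_marks c (u w : nat) : 'I_2 -> nat :=
  fun i => if (i == ord0) (+) c then u else w.

Lemma two_marks_swap c u w : two_marks (~~ c) u w = two_marks c w u.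
Proof. by apply/funext => i; rewrite /two_marks; case: (i == ord0); case: c. Qed.

Variable f : mgborel R 1 -> \bar R.
Hypothesis mf : measurable_fun setT f.
Hypothesis f_ge0 : (forall t, 0 <= f t)%E.

Let F c u w (x : measurableTypeR R) : \bar R :=
  f (random_mtree b_ge2 spare_growth (two_marks c u w) x).

Let mF c u w : measurable_fun setT (F c u w).
Proof. by apply: (measurableT_comp mf); exact: measurable_random_mtree. Qed.

Let F_ge0 c u w x : (0 <= F c u w x)%E. Proof. exact: f_ge0. Qed.

Lemma esum_random_tree c x :
  (\esum_(y in [set: vertex (rep (random_tree b_ge2 spare_growth x))])
     f (mark_pair R c y) = \sum_(w <oo) F c 0 w x)%E.
Proof.
set T := mtree (real_digit b x) (fun _ : 'I_1 => 0%N).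
rewrite (esum_mark_pair_iso c f (repr_pi R T : mg_iso (rep (random_tree b_ge2 spare_growth x)) T)).
rewrite esum_mark_pairE.
rewrite nneseries_esumT; last by move=> w; exact: F_ge0.
rewrite (_ : vtx T = [set: nat]); last by apply/seteqP; split=> // w _; exact: tvtxT.
apply: eq_esum => w _; congr f; apply/pi_mg_iso.
exists id; split; [by have [] := induced_iso_id T (vtx T)|by []|].
by move=> i; rewrite rootn_add_mark //; exact: tvtxT.
Qed.

Let digits_of m j := real_digit b ((j%:R / (N m)%:R) : R).
Let tw m j := twist b (digits_of m j) m.

Let weight_gt0R m : 0 < (N m)%:R :> R.
Proof. by rewrite ltr0n weight_gt0. Qed.

Let truncn_grid m (j : nat) : Num.truncn ((j%:R / (N m)%:R : R) * (N m)%:R) = j.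
Proof. by rewrite divfK ?gt_eqF // natrK. Qed.

Lemma F_shift c m j w y : 0 <= y < (N m)%:R^-1 ->
  F c 0 w (y + j%:R / (N m)%:R) = F c (tw m j 0) (tw m j w) y.
Proof.
move=> y01; have [lo hi] := real_digit_shift b_ge2 j y01.
rewrite /F; congr f; apply/pi_mg_iso.
rewrite (_ : two_marks c (tw m j 0) (tw m j w) =
  twist b (real_digit b (y + j%:R / (N m)%:R)) m \o two_marks c 0 w).
  by apply: mtree_twist => // l ml; rewrite hi.
apply/funext => i; rewrite /= /two_marks /tw.
have e l : (l < m)%N -> digits_of m j l = real_digit b (y + j%:R / (N m)%:R) l.
  apply: eq_real_digit => //; rewrite truncn_grid.
  move/andP: y01 => [y0 y1]; rewrite mulrDl divfK ?gt_eqF // truncn_addn ?mulr_ge0 //.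
  rewrite (_ : Num.truncn _ = 0%N) //; apply/truncn0Pn.
  by rewrite -ltNge -ltr_pdivlMr // div1r.
by case: ifP => _; exact: eq_twist.
Qed.

Let tw_lt m j (w : 'I_(N m)) : (tw m j w < N m)%N.
Proof. by rewrite ltn_twist. Qed.

Let tw_ord m j (w : 'I_(N m)) : 'I_(N m) := Ordinal (tw_lt j w).

Let zero_ord m : 'I_(N m) := Ordinal (weight_gt0 b_ge2 m).

Let tw_ord_inj m j : injective (@tw_ord m j).
Proof. by move=> w w' /(congr1 val) /= /(twist_inj b_ge2)/val_inj. Qed.

(** The first [m] digits of j / N_m determine [j]. So the root, at digits 0 before the shift, visits
    each vertex of T_m exactly once. *)
Let grid_inj m : injective (fun j : 'I_(N m) => tw_ord j (zero_ord m)).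
Proof.
move=> j j' /(congr1 val) /= e; apply: val_inj => /=.
rewrite -(truncn_grid m j) -(truncn_grid m j').
have in01 (i : 'I_(N m)) : 0 <= (i%:R / (N m)%:R : R) < 1.
  by rewrite divr_ge0 //= ltr_pdivrMr // mul1r ltr_nat.
apply: (real_digits_inj b_ge2) => // l lm.
have := congr1 (digit b l) e; rewrite !digit_twist // digit_eq0 ?weight_gt0 //.
by rewrite !add0n /digits_of /real_digit !modn_mod.
Qed.

(** Cut [0, 1] into N_m intervals. On the [j]-th one the root is moved to [tw m j 0], which runs
    over T_m, while for fixed [j] the other mark is permuted: all ordered pairs in T_m occur
    once. *)
Lemma sum_integral_marks c m : (\sum_(w < N m) \int[unif]_x F c 0 w x =
  \sum_(i < N m) \sum_(l < N m) \int[leb]_(y in `[0%R, ((N m)%:R^-1)%R[) F c i l y)%E.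
Proof.
transitivity (\sum_(w < N m) \sum_(j < N m)
    \int[leb]_(y in `[0%R, ((N m)%:R^-1)%R[) F c (tw m j 0) (tw m j w) y)%E.
  apply: eq_bigr => w _; rewrite (integral_uniform_split (weight_gt0 b_ge2 m)) //.
  apply: eq_bigr => j _; apply: eq_integral => y /set_mem /=.
  by rewrite in_itv /=; exact: F_shift.
rewrite exchange_big [RHS](reindex_inj (@grid_inj m)) /=.
by apply: eq_bigr => j _; rewrite [RHS](reindex_inj (@tw_ord_inj m j)).
Qed.

Lemma integral_random_tree c :
  (\int[random_tree_law R b_ge2 spare_growth]_t
     (\esum_(y in [set: vertex (rep t)]) f (mark_pair R c y)) =
   \sum_(w <oo) \int[unif]_x F c 0 w x)%E.
Proof.
rewrite ge0_integral_distribution; last 2 first.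
- exact: measurable_esum_mark.
- by move=> t; exact: esum_ge0.
rewrite -integral_nneseries //.
by apply: eq_integral => x _; exact: esum_random_tree.
Qed.

Lemma mass_transport :
  (\int[random_tree_law R b_ge2 spare_growth]_t
     (\esum_(y in [set: vertex (rep t)]) f (mark_pair R false y)) =
   \int[random_tree_law R b_ge2 spare_growth]_t
     (\esum_(y in [set: vertex (rep t)]) f (mark_pair R true y)))%E.
Proof.
rewrite !integral_random_tree.
have E m : (\sum_(0 <= w < N m) \int[unif]_x F false 0 w x =
    \sum_(0 <= w < N m) \int[unif]_x F true 0 w x)%E.
  (* Exchanging the sums over the two marks has the effect of flipping [c]. *)
  rewrite !big_mkord !sum_integral_marks exchange_big.
  apply: eq_bigr => i _; apply: eq_bigr => l _; apply: eq_integral => y _.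
  by rewrite /F -two_marks_swap.
have le n : (n <= N n)%N by rewrite ltnW // ltn_weight.
have ge0 c w : (0 <= \int[unif]_x F c 0 w x)%E by exact: integral_ge0.
by apply/eqP; rewrite eq_le !(@le_nneseries_subseq _ _ _ N) // => n; rewrite E.
Qed.
End mass_transport.

Theorem theorem2 (R : realType) (g : R -> R)
    (g_ge0 : forall x : R, 0 <= x -> 0 <= g x)
    (g_incr : strictly_increasing g)
    (g_super : super_additive g)
    (g_logc : eventually_log_concave g) :
  exists mu : random_rooted_graph R,
    [/\ unimodular mu,
        {ae mu, forall t : mgborel R 0, is_tree (rep t)} &
        uniform_growth mu g].
Proof.
have [r0 [r0_gt0 [gr0_gt0 [b [b_ge2 growth radix]]]]] :=
  growth_bases g_ge0 g_incr g_super g_logc.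
exists (random_tree_law R b_ge2 growth); split.
- move=> f mf f_ge0; apply: (mass_transport b_ge2 growth (f := EFin \o f)).
    exact/measurable_EFinP.
  by move=> t; rewrite lee_fin.
- apply: (@random_tree_law_local R b b_ge2 growth (fun G => is_tree G)) => G near_mtree.
  apply: is_tree_local => n.
  have [d nd] := near_mtree n.
  by exists (mtree b_ge2 growth d (fun=> 0%N)) => //; exact: tgraph_tree.
- exists (r0 / 4), (2 * g r0)^-1, (4 * r0), (100 / g r0).
  split; first by split; rewrite ?invr_gt0 ?divr_gt0 ?mulr_gt0.
  apply: (@random_tree_law_local R b b_ge2 growth (fun G => growth_bounds g _ _ _ _ G)) => G near_mtree.
  apply: (ball_size_growth_bounds g_incr r0_gt0 gr0_gt0 (N := base_weight b)).
  + by move=> n; case: (radix n).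
  + by move=> n; case: (radix n).
  + apply: ball_size_le_local => n; have [d nd] := near_mtree n.
    by exists (mtree b_ge2 growth d (fun=> 0%N)) => //; exact: tgraph_ball_size_le.
  + apply: ball_size_ge_local => n; have [d nd] := near_mtree n.
    by exists (mtree b_ge2 growth d (fun=> 0%N)) => //; exact: tgraph_ball_size_ge.
Qed.
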